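(* Consider the parametric convex mixed-integer optimal control problem with fixed initial state described in the context, with the standing assumptions listed there. For any $\bar\lambda\in\Lambda$ and any bounded neighborhood $B(\bar\lambda)\subset\Lambda$ of $\bar\lambda$ satisfying the constraint qualification (CQ) defined in the context, it holds $$|\nu(\lambda_1)-\nu(\lambda_2)|\le\tilde C\,|\lambda_1-\lambda_2|\quad\text{for all }\lambda_1,\lambda_2\in B(\bar\lambda),$$ where $\tilde C$ is the real number $$\tilde C=\sup_{(\hat u,\hat v)\in\bar S(y_0)}\Bigl[L_\varphi(|y(\hat u,\hat v)|,|\hat u|)+M\,L_g(|\hat u|)\,\sup_{\hat\rho\in\Omega(\bar\lambda)}\max_{1\le k\le M}\int_{t_0}^{t_{\mathrm f}}\mathrm d\hat\rho_k(s)\Bigr]+2\sup_{\lambda_1,\lambda_2\in B(\bar\lambda)}|\lambda_1-\lambda_2|,$$ with $\bar S(y_0)$ and $\Omega(\bar\lambda)$ as defined in the context (the term with factor $M$ being $0$ if $M=0$). That is, the optimal value function $\nu$ is Lipschitz continuous in a neighborhood of $\bar\lambda$ with Lipschitz constant $\tilde C$.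
   Context: Setting. $Y$ and $\Lambda$ are Banach spaces, $U$ is a complete metric space (carrying a linear structure, so that the linearity and convexity assumptions below make sense), $\mathcal V$ is a finite set (identified with $\{0,1,\ldots,N-1\}$), $[t_0,t_{\mathrm f}]$ with $t_0<t_{\mathrm f}$ is a finite time horizon, and $f\colon[t_0,t_{\mathrm f}]\times Y\times U\times\mathcal V\to Y$. $A\colon D(A)\to Y$ generates a strongly continuous semigroup $\{T(t)\}_{t\ge0}$ of bounded linear operators on $Y$. $U_{[t_0,t_{\mathrm f}]}$ is a Banach space of (Lebesgue-)measurable functions $u\colon[t_0,t_{\mathrm f}]\to U$, and $V_{[t_0,t_{\mathrm f}]}=L^\infty(t_0,t_{\mathrm f};\mathcal V)$ is the set of measurable functions $v\colon[t_0,t_{\mathrm f}]\to\mathcal V$. $|\cdot|$ denotes the norm of the respective space; on $C([t_0,t_{\mathrm f}];Y)$ it is the supremum norm. The initial state $y_0\in Y$ is fixed (independent of $\lambda$). $M$ is a nonnegative integer, and for every $v\in V_{[t_0,t_{\mathrm f}]}$ functions $g_1^v,\ldots,g_M^v\colon\Lambda\times U_{[t_0,t_{\mathrm f}]}\times[t_0,t_{\mathrm f}]\to\mathbb R$ are given. The set of admissible controls is $$W_{[t_0,t_{\mathrm f}]}(\lambda)=\{(u,v)\in U_{[t_0,t_{\mathrm f}]}\times V_{[t_0,t_{\mathrm f}]}: g_k^v(\lambda,u,t)\le0,\ k=1,\ldots,M,\ t\in[t_0,t_{\mathrm f}]\}.$$ For $u\in U_{[t_0,t_{\mathrm f}]}$,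 $v\in V_{[t_0,t_{\mathrm f}]}$, $y(u,v)\in C([t_0,t_{\mathrm f}];Y)$ denotes the mild solution of $\dot y(t)=Ay(t)+f(t,y(t),u(t),v(t))$, $y(t_0)=y_0$, i.e. the solution of $$y(t)=T(t-t_0)y_0+\int_{t_0}^tT(t-s)f(s,y(s),u(s),v(s))\,ds,\quad t\in[t_0,t_{\mathrm f}],$$ which is understood to exist for all such $u,v$. The optimal value is $$\nu(\lambda)=\inf\{\varphi(\lambda,y(u,v),u,v):(u,v)\in W_{[t_0,t_{\mathrm f}]}(\lambda)\}\in\mathbb R\cup\{\pm\infty\}.$$ Standing assumptions. 1. For each $v\in\mathcal V$ the map $f\colon[t_0,t_{\mathrm f}]\times Y\times U\times\{v\}\to Y$ is continuous, and there is $k\in L^1(t_0,t_{\mathrm f})$ such that for all $\lambda\in\Lambda$, $(u,v)\in W_{[t_0,t_{\mathrm f}]}(\lambda)$, $y_1,y_2\in Y$ and almost every $t\in(t_0,t_{\mathrm f})$: $|f(t,y_1,u(t),v(t))-f(t,y_2,u(t),v(t))|\le k(t)|y_1-y_2|$ and $|f(t,0,u(t),v(t))|\le k(t)$. 2. $\varphi\colon\Lambda\times C([t_0,t_{\mathrm f}];Y)\times U_{[t_0,t_{\mathrm f}]}\times V_{[t_0,t_{\mathrm f}]}\to\mathbb R$ is continuous, and $W_{[t_0,t_{\mathrm f}]}(\lambda)\ne\emptyset$ for all $\lambda\in\Lambda$. 3. The map $(y,u)\mapsto f(t,y,u,v)$ is linear and the map $(y,u)\mapsto\varphi(\lambda,y,u,v)$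 is convex. There is a continuous $L_\varphi\colon[0,\infty)^2\to[0,\infty)$ with $|\varphi(\lambda_1,y,u,v)-\varphi(\lambda_2,y,u,v)|\le L_\varphi(|y|,|u|)\,|\lambda_1-\lambda_2|$. For all $k=1,\ldots,M$ the maps $u\mapsto g_k^v(\lambda,u,t)$ are convex, the maps $(u,t)\mapsto g_k^v(\lambda,u,t)$ are continuous, and there is a continuous $L_g\colon[0,\infty)\to[0,\infty)$ with $|g_k^v(\lambda_1,u,t)-g_k^v(\lambda_2,u,t)|\le L_g(|u|)\,|\lambda_1-\lambda_2|$ for all $t\in[t_0,t_{\mathrm f}]$. The functions $L_\varphi$, $L_g$ are fixed. Constraint qualification (CQ) for $\bar\lambda$ and the bounded neighborhood $B(\bar\lambda)$: there exist $\omega>0$ and, for every $v\in V_{[t_0,t_{\mathrm f}]}$, a Slater point $\bar u_v\in U_{[t_0,t_{\mathrm f}]}$ such that for all $\lambda\in B(\bar\lambda)$, $g_k^v(\lambda,\bar u_v,t)\le-\omega$ for all $t\in[t_0,t_{\mathrm f}]$, $k=1,\ldots,M$; moreover $$\sup_{v\in V_{[t_0,t_{\mathrm f}]}}\sup_{\lambda\in B(\bar\lambda)}\varphi(\lambda,y(\bar u_v,v),\bar u_v,v)<\infty;$$ there is a number $\underline\alpha$ with $\nu(\lambda)\ge\underline\alpha$ for all $\lambda\in B(\bar\lambda)$; and the set $$\bar S(y_0)=\bigcup_{\lambda_1,\lambda_2\in B(\bar\lambda)}\bigl\{(u,v)\in W_{[t_0,t_{\mathrm f}]}(\lambda_1):\varphi(\lambda_1,y(u,v),u,v)\le\varphi(\lambda_1,y(\bar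 u_v,v),\bar u_v,v)+|\lambda_1-\lambda_2|^2\bigr\}$$ is bounded. Dual quantities. $C([t_0,t_{\mathrm f}])^\ast_+$ is the cone of nonnegative elements of the dual of $C([t_0,t_{\mathrm f}])$, represented by nondecreasing functions of bounded variation (equivalently, finite nonnegative Borel measures), with integrals taken in the Riemann–Stieltjes sense. For $v\in V_{[t_0,t_{\mathrm f}]}$, $u\in U_{[t_0,t_{\mathrm f}]}$, $\mu^\ast\in(C([t_0,t_{\mathrm f}])^\ast_+)^M$ let $$\mathcal L_v(\lambda,u,\mu^\ast)=\varphi(\lambda,y(u,v),u,v)+\sum_{k=1}^M\int_{t_0}^{t_{\mathrm f}}g_k^v(\lambda,u,s)\,\mathrm d\mu_k^\ast(s),\qquad h_v(\lambda,\mu^\ast)=\inf_{u\in U_{[t_0,t_{\mathrm f}]}}\mathcal L_v(\lambda,u,\mu^\ast),$$ $$F_v(\lambda)=\{\mu^\ast\in(C([t_0,t_{\mathrm f}])^\ast_+)^M:h_v(\lambda,\mu^\ast)>-\infty\},$$ $$G(\lambda)=\Bigl\{\rho=(\rho_v)_v\in\prod_{v\in V_{[t_0,t_{\mathrm f}]}}F_v(\lambda):\inf_{v\in V_{[t_0,t_{\mathrm f}]}}h_v(\lambda,\rho_v)\in\mathbb R\Bigr\},$$ and, for $\varepsilon\ge0$, $H(\lambda,\varepsilon)=\{\rho\in G(\lambda):\inf_{v\in V_{[t_0,t_{\mathrm f}]}}h_v(\lambda,\rho_v)\ge\nu(\lambda)-\varepsilon\}$. Finally $$\Omega(\bar\lambda)=\bigcup_{\lambda_1,\lambda_2\in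 B(\bar\lambda),\,v\in V_{[t_0,t_{\mathrm f}]}}\{\rho_v:\rho\in H(\lambda_1,|\lambda_1-\lambda_2|^2)\}\subset(C([t_0,t_{\mathrm f}])^\ast_+)^M.$$ *)

(* Defs.v *)
From HB Require Import structures.
From mathcomp Require Import all_boot all_order all_algebra.
From mathcomp Require Import all_classical all_reals all_analysis.
From mathcomp Require Import measurable_realfun ess_sup_inf.

Set Implicit Arguments.
Unset Strict Implicit.
Unset Printing Implicit Defensive.

Import Order.TTheory GRing.Theory Num.Theory.
Import numFieldNormedType.Exports.

Local Open Scope classical_set_scope.
Local Open Scope ring_scope.

Section metric.
Context {R : realType} {U : preTopologicalLmodType R}.

(* d is a complete metric inducing the topology of U.  No compatibility of the
   linear structure of U with d is required. *)
Definition complete_metric (d : U -> U -> R) : Prop :=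
  [/\ [/\ forall x y, 0 <= d x y, forall x y, d x y = 0 <-> x = y,
          forall x y, d x y = d y x & forall x y z, d x z <= d x y + d y z],
      forall (x : U) (A : set U),
        nbhs x A <-> exists2 e : R, 0 < e & [set y | d x y < e] `<=` A
    & forall w : nat -> U,
        (forall e : R, 0 < e -> exists m : nat, forall i j : nat,
           (m <= i)%N -> (m <= j)%N -> d (w i) (w j) < e) ->
        exists x : U, w n @[n --> \oo] --> x].

End metric.

(* Functions on [t0, tf] are represented by total functions on R, of which only
   the values on [t0, tf] are meaningful. *)

Section integration.
Context {R : realType}.

(* [measurable] on R is the Borel sigma-algebra; this is its completion. *)
Definition lebesgue_measurable (A : set R) : Prop :=
  completed_algebra_gen (@lebesgue_measure R) A.

Section bochner.
Context {Y : normedModType R}.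

Definition simple_function (s : R -> Y) : Prop :=
  finite_set (range s) /\ forall c, measurable (s @^-1` [set c]).

(* For D of finite Lebesgue measure. *)
Definition simple_integral (D : set R) (s : R -> Y) : Y :=
  \sum_(c \in range s) fine (lebesgue_measure (D `&` s @^-1` [set c])) *: c.

(* The Bochner integral of h over D exists and equals I: h is the a.e. limit of
   a sequence of simple functions that is Cauchy in mean, and I is the limit of
   their integrals. *)
Definition has_bochner_integral (D : set R) (h : R -> Y) (I : Y) : Prop :=
  exists s : nat -> R -> Y,
    [/\ forall n, simple_function (s n),
        {ae lebesgue_measure, forall t, D t -> s n t @[n --> \oo] --> h t},
        forall e : R, 0 < e -> exists m : nat, forall i j : nat,
          (m <= i)%N -> (m <= j)%N ->
          (\int[lebesgue_measure]_(t in D) `|s i t - s j t|%:E < e%:E)%E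
      & simple_integral D (s n) @[n --> \oo] --> I].

End bochner.

(* s lists the nodes of the partition other than a, x the tags. *)
Definition is_RS_integral (a b : R) (g F : R -> R) (I : R) : Prop :=
  forall e : R, 0 < e -> exists2 d : R, 0 < d & forall s x : seq R,
    itv_partition a b s -> size x = size s ->
    (forall i : nat, (i < size s)%N ->
       (a :: s)`_i.+1 - (a :: s)`_i < d /\
       (a :: s)`_i <= x`_i <= (a :: s)`_i.+1) ->
    `|\sum_(i < size s) g x`_i * (F (a :: s)`_i.+1 - F (a :: s)`_i) - I| < e.

(* int_a^b g dF, with default value 0 when the integral does not exist *)
Definition RS_integral (a b : R) (g F : R -> R) : R :=
  xget 0 [set I | is_RS_integral a b g F I].

End integration.

Section semigroup.
Context {R : realType} {Y : normedModType R}.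

(* T t is only meaningful for t >= 0. *)
Definition C0_semigroup (T : R -> Y -> Y) : Prop :=
  [/\ forall t, 0 <= t -> linear (T t) /\
        exists C : R, forall x, `|T t x| <= C * `|x|,
      forall x, T 0 x = x,
      forall s t x, 0 <= s -> 0 <= t -> T (s + t) x = T s (T t x)
    & forall x, T t x @[t --> 0^'+] --> x].

(* The operator A with domain DA is the infinitesimal generator of T. *)
Definition generates (DA : set Y) (A : Y -> Y) (T : R -> Y -> Y) : Prop :=
  forall x z : Y,
    (DA x /\ A x = z) <-> (h^-1 *: (T h x - x) @[h --> 0^'+] --> z).

End semigroup.

Section spaces.
Context {R : realType}.
Variables (t0 tf : R).

Definition Cspace {Y : normedModType R} : set (R -> Y) :=
  [set z | {within `[t0, tf], continuous z}].

Definition sup_norm {Y : normedModType R} (z : R -> Y) : R :=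
  sup [set `|z t| | t in `[t0, tf]].

Definition Vspace {N : nat} : set (R -> 'I_N) :=
  [set v | forall i, lebesgue_measurable (`[t0, tf] `&` v @^-1` [set i])].

(* the L^oo(t0, tf) distance, 'I_N being identified with {0, ..., N-1} *)
Definition Linfty_dist {N : nat} (v w : R -> 'I_N) : \bar R :=
  ess_sup lebesgue_measure
    (fun t => (`|(v t)%:R - (w t)%:R| * \1_(`[t0, tf]%classic : set R) t)%:E).

(* The elements of the vector space X are measurable functions
   [t0, tf] -> U, x being the function ev x.  Vector operations need only agree
   with the pointwise ones almost everywhere, so that X may also consist of
   classes modulo a.e. equality (L^p), ev then picking representatives. *)
Definition measurable_function_space (X : lmodType R)
    (U : preTopologicalLmodType R) (ev : X -> R -> U) : Prop :=
  [/\ forall x (O : set U), open O ->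
        lebesgue_measurable (`[t0, tf] `&` ev x @^-1` O),
      forall (a : R) x1 x2, {ae lebesgue_measure, forall t, t \in `[t0, tf] ->
        ev (a *: x1 + x2) t = a *: ev x1 t + ev x2 t}
    & forall x1 x2, (forall t, t \in `[t0, tf] -> ev x1 t = ev x2 t) ->
        x1 = x2].

End spaces.

Section problem.
Context {R : realType} {Y L X : completeNormedModType R}
  {U : preTopologicalLmodType R} {N M : nat}.
Variables (t0 tf : R).

Definition mild_solution (T : R -> Y -> Y) (f : R -> Y -> U -> 'I_N -> Y)
    (y0 : Y) (u : R -> U) (v : R -> 'I_N) (z : R -> Y) : Prop :=
  Cspace t0 tf z /\
  forall t, t \in `[t0, tf] -> exists2 I : Y,
    has_bochner_integral `[t0, t]
      (fun s => T (t - s) (f s (z s) (u s) (v s))) I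
    & z t = T (t - t0) y0 + I.

(* continuity on L x C([t0,tf];Y) x X x L^oo(t0,tf;{0..N-1}) *)
Definition continuous_cost (phi : L -> (R -> Y) -> X -> (R -> 'I_N) -> R) :
    Prop :=
  forall l z u v, Cspace t0 tf z -> Vspace t0 tf v ->
  forall e : R, 0 < e -> exists2 d : R, 0 < d &
    forall l' z' u' v', Cspace t0 tf z' -> Vspace t0 tf v' ->
      `|l' - l| < d -> sup_norm t0 tf (z' - z) < d -> `|u' - u| < d ->
      (Linfty_dist t0 tf v' v < d%:E)%E ->
      `|phi l' z' u' v' - phi l z u v| < e.

Variable g : (R -> 'I_N) -> 'I_M -> L -> X -> R -> R.

Definition admissible (l : L) : set (X * (R -> 'I_N)) :=
  [set p | Vspace t0 tf p.2 /\
    forall k t, t \in `[t0, tf] -> g p.2 k l p.1 t <= 0].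

Variable phi : L -> (R -> Y) -> X -> (R -> 'I_N) -> R.
Variable y : X -> (R -> 'I_N) -> R -> Y.

Definition nu (l : L) : \bar R :=
  ereal_inf [set (phi l (y p.1 p.2) p.1 p.2)%:E | p in admissible l].

Definition Sbar (B : set L) (ubar : (R -> 'I_N) -> X) :
    set (X * (R -> 'I_N)) :=
  [set p | exists l1 l2, [/\ B l1, B l2, admissible l1 p &
    phi l1 (y p.1 p.2) p.1 p.2 <=
    phi l1 (y (ubar p.2) p.2) (ubar p.2) p.2 + `|l1 - l2| ^+ 2]].

(* Boundedness of Sbar only concerns the first component, the second one taking
   its values in {0, ..., N-1}. *)
Definition CQ (B : set L) (ubar : (R -> 'I_N) -> X) : Prop :=
  [/\ exists2 w : R, 0 < w & forall v l k t, Vspace t0 tf v -> B l ->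
        t \in `[t0, tf] -> g v k l (ubar v) t <= - w,
      (ereal_sup [set ereal_sup
         [set (phi l (y (ubar v) v) (ubar v) v)%:E | l in B]
         | v in Vspace t0 tf] < +oo)%E,
      exists alpha : R, forall l, B l -> (alpha%:E <= nu l)%E
    & bounded_set [set p.1 | p in Sbar B ubar]].

(* nonnegative elements of the dual of C([t0,tf]), M-fold, represented by
   nondecreasing integrators *)
Definition dual_cone : set ('I_M -> R -> R) :=
  [set m | forall k, {in `[t0, tf] &, nondecreasing (m k)}].

Definition lagrangian (v : R -> 'I_N) (l : L) (u : X) (m : 'I_M -> R -> R) :
    R :=
  phi l (y u v) u v + \sum_(k < M) RS_integral t0 tf (g v k l u) (m k).

Definition dual_fun (v : R -> 'I_N) (l : L) (m : 'I_M -> R -> R) : \bar R :=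
  ereal_inf [set (lagrangian v l u m)%:E | u in [set: X]].

Definition F_set (v : R -> 'I_N) (l : L) : set ('I_M -> R -> R) :=
  [set m | dual_cone m /\ (-oo < dual_fun v l m)%E].

Definition inf_dual (l : L) (rho : (R -> 'I_N) -> 'I_M -> R -> R) : \bar R :=
  ereal_inf [set dual_fun v l (rho v) | v in Vspace t0 tf].

Definition G_set (l : L) : set ((R -> 'I_N) -> 'I_M -> R -> R) :=
  [set rho | (forall v, Vspace t0 tf v -> F_set v l (rho v)) /\
             inf_dual l rho \is a fin_num].

Definition H_set (l : L) (e : R) : set ((R -> 'I_N) -> 'I_M -> R -> R) :=
  [set rho | G_set l rho /\ (nu l - e%:E <= inf_dual l rho)%E].

Definition Omega (B : set L) : set ('I_M -> R -> R) :=
  [set m | exists l1 l2 v rho, [/\ B l1, B l2, Vspace t0 tf v,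
    H_set l1 (`|l1 - l2| ^+ 2) rho & m = rho v]].

(* The maximum over k is that of nonnegative numbers, and is 0 if M = 0. *)
Definition Ctilde (Lphi : R -> R -> R) (Lg : R -> R) (B : set L)
    (ubar : (R -> 'I_N) -> X) : \bar R :=
  (ereal_sup [set
     (Lphi (sup_norm t0 tf (y p.1 p.2)) `|p.1|)%:E +
     (M%:R * Lg `|p.1|)%:E *
     ereal_sup [set (\big[Num.max/0%R]_(k < M)
                       RS_integral t0 tf (fun=> 1%R) (m k))%:E
               | m in Omega B]
     | p in Sbar B ubar] +
   2%:E * ereal_sup [set `|l1 - l2|%:E | l1 in B & l2 in B])%E.

End problem.

(* Main.v *)
Require Import Defs.
From HB Require Import structures.
From mathcomp Require Import all_boot all_order all_algebra.
From mathcomp Require Import all_classical all_reals all_analysis.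
From mathcomp Require Import measurable_realfun ess_sup_inf ring lra.

(* Fix lambda1 <> lambda2 in B and put d = |lambda1 - lambda2|.  Take (u, v)
   admissible at lambda1 and d^2-optimal, and multipliers rho that are
   d^2-optimal for the dual problem at lambda2.  Then
     nu(lambda2) - d^2 <= h_v(lambda2, rho_v) <= L_v(lambda2, u, rho_v)
       <= L_v(lambda1, u, rho_v) + (L_phi + M L_g |rho_v|) d
       <= nu(lambda1) + d^2 + (L_phi + M L_g |rho_v|) d,
   since g(lambda1, u, .) <= 0 and rho_v >= 0.

   Such rho exist by strong duality for fixed v.  As f is linear in (y, u), the
   state y(u, v) is affine in u (uniqueness by Gronwall), so the reduced cost is
   convex.  The directional derivative at 0 of the value function, as a function
   of a bounded perturbation of the constraints, is sublinear and finite by the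
   Slater condition.  A linear functional below it, given by Hahn-Banach on all
   bounded functions (not only the continuous ones), can be evaluated at
   indicators of intervals, and this directly yields the nondecreasing
   integrators, without the Riesz representation theorem.

   The constant is finite because Gronwall bounds the states over the bounded
   set S, and evaluating the Lagrangian at the Slater points bounds the total
   mass of all almost optimal multipliers. *)

Set Implicit Arguments.
Unset Strict Implicit.
Unset Printing Implicit Defensive.

Import Order.TTheory GRing.Theory Num.Theory.
Import numFieldNormedType.Exports.

Local Open Scope classical_set_scope.
Local Open Scope ring_scope.

(** * Hahn-Banach *)

Section hahn_banach.
Context {R : realType} {V : lmodType R}.

(** Functionals are total on [V] and constrained only on the subspace [D]. Homogeneity is stated as
    an inequality; applying it to the inverse scalar as well gives equality. *)
Definition sublinear_on (D : set V) (p : V -> R) : Prop :=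
  (forall x y, D x -> D y -> p (x + y) <= p x + p y) /\
  (forall a x, 0 < a -> D x -> p (a *: x) <= a * p x).

Definition linear_on (D : set V) (l : V -> R) : Prop :=
  (forall x y, D x -> D y -> l (x + y) = l x + l y) /\
  (forall a x, D x -> l (a *: x) = a * l x).

Variable D : set V.
Hypotheses (D0 : D 0) (DD : forall x y, D x -> D y -> D (x + y))
  (DZ : forall a x, D x -> D (a *: x)).

Let DN x : D x -> D (- x). Proof. by rewrite -scaleN1r; exact: DZ. Qed.

Lemma sublinear_onZ (p : V -> R) a x :
  sublinear_on D p -> 0 < a -> D x -> p (a *: x) = a * p x.
Proof.
move=> [_ pZ] a0 Dx; apply/eqP; rewrite eq_le pZ//=.
have ai0 : 0 < a^-1 by rewrite invr_gt0.
have := pZ _ _ ai0 (DZ a Dx).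
rewrite scalerA mulVf ?gt_eqF// scale1r => h.
by rewrite -(ler_pM2l ai0) mulrA mulVf ?gt_eqF// mul1r.
Qed.

Lemma sublinear_on0 (p : V -> R) : sublinear_on D p -> p 0 = 0.
Proof.
move=> sp; have := sublinear_onZ sp (ltr0n R 2) D0; rewrite scaler0; lra.
Qed.

Lemma sublinear_onN (p : V -> R) x : sublinear_on D p -> D x -> - p (- x) <= p x.
Proof.
move=> sp Dx; have := sp.1 _ _ Dx (DN Dx).
by rewrite subrr (sublinear_on0 sp); lra.
Qed.

Let sub_le (p q : V -> R) := sublinear_on D q /\ forall x, D x -> q x <= p x.

(* For y in D, the sublinear functional
   r x = inf_(t >= 0) (q (x + t y) - t q y) lies below q, hence equals q by
   minimality; t = 1 gives additivity. *)
Lemma minimal_sublinear_linear (q : V -> R) : sublinear_on D q ->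
  (forall r, sub_le q r -> forall x, D x -> q x <= r x) -> linear_on D q.
Proof.
move=> sq minq.
have qD x y : D x -> D y -> q (x + y) = q x + q y.
  move=> Dx Dy; apply/eqP; rewrite eq_le sq.1//=.
  pose S z := [set q (z + t *: y) - t * q y | t in [set t | 0 <= t]].
  have S0 z : S z !=set0 by exists (q (z + 0 *: y) - 0 * q y), 0 => /=.
  have qty t : 0 <= t -> q (t *: y) = t * q y.
    rewrite le_eqVlt => /predU1P[<-|t0]; last exact: sublinear_onZ.
    by rewrite scale0r mul0r sublinear_on0.
  have lbS z : D z -> lbound (S z) (- q (- z)).
    move=> Dz _ [t /= t0 <-].
    have := sq.1 _ _ (DD Dz (DZ t Dy)) (DN Dz).
    by rewrite addrC addrA addNr add0r qty//; lra.
  pose r z := inf (S z).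
  have rle z t : D z -> 0 <= t -> r z <= q (z + t *: y) - t * q y.
    by move=> Dz t0; apply: ge_inf; [exists (- q (- z)); exact: lbS|exists t].
  have ler z c : (forall t, 0 <= t -> c <= q (z + t *: y) - t * q y) -> c <= r z.
    by move=> h; apply: lb_le_inf => // _ [t /= t0 <-]; exact: h.
  suff /minq/(_ _ Dx) : sub_le q r.
    by have := rle x 1 Dx ler01; rewrite scale1r mul1r; lra.
  split; last first.
    by move=> z Dz; have := rle z 0 Dz (lexx _); rewrite scale0r mul0r addr0 subr0.
  split=> [z w Dz Dw|a z a0 Dz].
    rewrite -lerBlDr; apply: (ler _ _) => t t0; rewrite lerBlDl -lerBlDr.
    apply: (ler _ _) => s s0; rewrite lerBlDr.
    have := rle (z + w) (t + s) (DD Dz Dw) (addr_ge0 t0 s0).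
    have := sq.1 _ _ (DD Dz (DZ t Dy)) (DD Dw (DZ s Dy)).
    by rewrite scalerDl addrACA; lra.
  rewrite -ler_pdivrMl//; apply: (ler _ _) => t t0.
  rewrite ler_pdivrMl//.
  have := rle (a *: z) (a * t) (DZ a Dz) (mulr_ge0 (ltW a0) t0).
  rewrite -scalerA -scalerDr (sublinear_onZ sq a0 (DD Dz (DZ t Dy))).
  by rewrite -mulrA -mulrBr.
split=> // a x Dx.
have qN z : D z -> q (- z) = - q z.
  move=> Dz; have := qD _ _ Dz (DN Dz); rewrite subrr sublinear_on0//; lra.
have [a0|a0|->] := ltrgtP a 0.
- rewrite -[a]opprK scaleNr qN; last exact: DZ.
  by rewrite sublinear_onZ ?oppr_gt0//; ring.
- exact: sublinear_onZ.
- by rewrite scale0r mul0r sublinear_on0.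
Qed.

(** Zorn's lemma gives a minimal sublinear functional below [p], and minimality forces linearity; no
    functional is extended from a smaller subspace. The order [le] is the reversed pointwise one on
    [D], so its maximal elements are the minimal functionals. *)
Theorem hahn_banach (p : V -> R) : sublinear_on D p ->
  exists2 l, linear_on D l & forall x, D x -> l x <= p x.
Proof.
move=> sp; pose T := {q : V -> R | sub_le p q}.
have pp : sub_le p p by split.
pose le (q r : T) : bool := `[< forall x, D x -> sval r x <= sval q x >].
have [||A Atot|] := @ZL_preorder T (exist _ p pp) le.
- by move=> q; exact/asboolP.
- move=> q r s /asboolP qr /asboolP rs; apply/asboolP => x Dx.
  exact: le_trans (rs _ Dx) (qr _ Dx).
- have [[q0 Aq0]|A0] := pselect (A !=set0); last first.
    by exists (exist _ p pp) => q Aq; exfalso; apply: A0; exists q.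
  pose S x := [set sval q x | q in A].
  have S0 x : S x !=set0 by exists (sval q0 x), q0.
  have lbS x : D x -> lbound (S x) (- p (- x)).
    move=> Dx _ [[q [sq qp]] Aq <-] /=.
    by have := sublinear_onN sq Dx; have := qp _ (DN Dx); lra.
  (* The infimum of the chain is its bound in the reversed order; it is finite because every member
     is at least [- p (- x)] at [x]. *)
  pose m x := inf (S x).
  have mle x q : D x -> A q -> m x <= sval q x.
    by move=> Dx Aq; apply: ge_inf; [exists (- p (- x)); exact: lbS|exists q].
  have lem x c : (forall q, A q -> c <= sval q x) -> c <= m x.
    by move=> h; apply: lb_le_inf => // _ [q Aq <-]; exact: h.
  have mp : sub_le p m.
    split; last first.
      move=> x Dx; apply: le_trans (mle _ _ Dx Aq0) _.
      exact: (svalP q0).2.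
    split=> [x y Dx Dy|a x a0 Dx].
      rewrite -lerBlDr; apply: (lem _ _) => q Aq; rewrite lerBlDl -lerBlDr.
      apply: (lem _ _) => r Ar; rewrite lerBlDr.
      (* Subadditivity holds within a single member of the chain, so the smaller of [q] and [r] is
         used for both terms. *)
      have [/asboolP h|/asboolP h] := Atot _ _ Aq Ar.
        apply: le_trans (mle _ r (DD Dx Dy) Ar) _.
        apply: le_trans ((svalP r).1.1 _ _ Dx Dy) _.
        by have := h _ Dx; lra.
      apply: le_trans (mle _ q (DD Dx Dy) Aq) _.
      apply: le_trans ((svalP q).1.1 _ _ Dx Dy) _.
      by have := h _ Dy; lra.
    rewrite -ler_pdivrMl//; apply: (lem _ _) => q Aq; rewrite ler_pdivrMl//.
    apply: le_trans (mle _ q (DZ _ Dx) Aq) _.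
    exact: (svalP q).1.2.
  exists (exist _ m mp) => q Aq; apply/asboolP => x Dx; exact: mle.
- move=> [q [sq qp]] qmin; exists q => //.
  apply: minimal_sublinear_linear => // r [sr rq] x Dx.
  have rp : sub_le p r by split=> // z Dz; exact: le_trans (rq _ Dz) (qp _ Dz).
  have /asboolP : le (exist _ r rp) (exist _ q (conj sq qp)).
    by apply: qmin; apply/asboolP.
  exact.
Qed.

End hahn_banach.

(** * Riemann-Stieltjes integrals *)

Section riemann_stieltjes.
Context {R : realType}.
Implicit Types (a b c d e : R) (g F : R -> R).

(** Compactness is used in near-covering form along [d] tending to 0 from the right: around each
    point all small [d] work locally, hence all small [d] work on the whole segment. *)
Lemma heine_cantor (V : normedModType R) a b (f : R -> V) (e : R) : 0 < e ->
  {within `[a, b], continuous f} -> exists2 d : R, 0 < d &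
  forall x y : R, a <= x <= b -> a <= y <= b -> `|x - y| < d -> `|f x - f y| < e.
Proof.
move=> e0 /subspace_continuousP cf.
have /near_covering_withinP : near_covering `[a, b].
  by rewrite -compact_near_coveringP; exact: segment_compact.
move=> /(_ R (0 : R)^'+ (fun d x => forall y : R, a <= y <= b -> `|x - y| < d ->
  `|f x - f y| < e)).
case.
- move=> x xab.
  have /cvgrPdist_lt/(_ (e / 2)) := cf _ xab.
  rewrite divr_gt0// => /(_ isT).
  rewrite /within /= => /nbhs_ballP[n /= n0 hn].
  exists (ball x (n / 2), [set d | d < n / 2]).
    split=> /=; first by apply: nbhsx_ballx; rewrite divr_gt0.
    by apply: nbhs_right_lt; rewrite divr_gt0.
  move=> [x' d] [/= xx' dn] x'ab y yab x'y.
  rewrite (splitr e); apply: le_lt_trans (ler_distD (f x) _ _) _; rewrite ltrD//.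
    rewrite distrC; apply: hn => //=; apply: le_ball xx'.
    by have := n0; lra.
  apply: hn; last by rewrite /= in_itv.
  rewrite /ball_ /= (splitr n); apply: le_lt_trans (ler_distD x' _ _) _.
  apply: ltrD; last exact: lt_trans dn.
  by move: xx'; rewrite -ball_normE.
- move=> d /= d0 hd; exists (d / 2); first by rewrite divr_gt0.
  move=> x y xab yab; apply: (hd (d / 2)) => //=; last by rewrite divr_gt0.
  by rewrite sub0r normrN gtr0_norm ?divr_gt0// ltr_pdivrMr// ltr_pMr// ltr1n.
Qed.

(* a is the left end point of the first cell *)
Fixpoint RS_sum g F a (s x : seq R) : R :=
  match s, x with
  | s1 :: s', x1 :: x' => g x1 * (F s1 - F a) + RS_sum g F s1 s' x'
  | _, _ => 0
  end.

Lemma RS_sumE g F a (s x : seq R) : size x = size s ->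
  \sum_(i < size s) g x`_i * (F (a :: s)`_i.+1 - F (a :: s)`_i) = RS_sum g F a s x.
Proof.
elim: s a x => [|s1 s ih] a [|x1 x]//=; first by rewrite big_ord0.
by move=> [xs]; rewrite big_ord_recl/= -ih.
Qed.

(* The tags need not lie in their cells, so that cells can be subdivided. *)
Fixpoint close_tagged g e a (s x : seq R) : Prop :=
  match s, x with
  | [::], [::] => True
  | s1 :: s', x1 :: x' => [/\ a <= s1,
      forall t, a <= t <= s1 -> `|g x1 - g t| <= e & close_tagged g e s1 s' x']
  | _, _ => False
  end.

Lemma close_tagged_le_last g e a (s x : seq R) : close_tagged g e a s x -> a <= last a s.
Proof.
elim: s a x => [|s1 s ih] a [|x1 x]//= [as1 _ /ih].
exact: le_trans.
Qed.

Definition nondecr_on a b F := forall t t', a <= t -> t <= t' -> t' <= b -> F t <= F t'.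

Lemma nondecr_onP a b F : {in `[a, b] &, nondecreasing F} -> nondecr_on a b F.
Proof.
by move=> h t t' at_ tt' tb; apply: h => //; rewrite in_itv/= ?at_ ?tb ?andbT//=;
  [exact: le_trans tb|exact: le_trans tt'].
Qed.

(* Induction on the number of cells, splitting the longer of the two first
   cells at the end of the shorter one. *)
Lemma RS_sum_close g F e a b (s x s' x' : seq R) : nondecr_on a b F ->
  close_tagged g e a s x -> close_tagged g e a s' x' -> last a s = b -> last a s' = b ->
  `|RS_sum g F a s x - RS_sum g F a s' x'| <= 2 * e * (F b - F a).
Proof.
move: {2}(size s + size s')%N (leqnn (size s + size s')) => n.
elim: n a s x s' x' => [|n ih] a s x s' x'.
  rewrite leqn0 addn_eq0 !size_eq0 => /andP[/eqP-> /eqP->] _.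
  by case: x => // _; case: x' => // _ /= <- _; rewrite !subrr normr0 mulr0.
wlog : s x s' x' / (0 < size s)%N /\ forall s1 s1', ohead s = Some s1 ->
    ohead s' = Some s1' -> s1 <= s1'.
  move=> wl szn Fm ts ts' ls ls'.
  case: s s' x x' szn ts ts' ls ls' => [|s1 s] [|s1' s'] [|x1 x] [|x1' x']//.
  - by move=> _ _ _ /= <- _; rewrite !subrr normr0 mulr0.
  - move=> szn ts ts' ls ls'; rewrite distrC; apply: wl => //; by rewrite addnC.
  - by move=> szn ts ts' ls ls'; apply: wl => //.
  - move=> szn ts ts' ls ls'; have [s11'|s11'] := leP s1 s1'.
      by apply: wl => //; split=> // ? ? [<-] [<-].
    rewrite distrC; apply: wl => //; last by rewrite addnC.
    by split=> // ? ? [<-] [<-]; exact: ltW.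
move=> -[]; case: s x => // s1 s [|x1 x] // _ hd szn Fm.
move=> [as1 close1 ts].
have s1b : last s1 s = b -> s1 <= b by move=> <-; exact: close_tagged_le_last ts.
case: s' x' hd szn => [|s1' s'] [|x1' x']// hd szn.
(* The second partition is exhausted, so [a = b] and the first cell of the other one is
   degenerate. *)
- move=> _ /= ls ab.
  have s1a : s1 = a by apply/eqP; rewrite eq_le as1 ab s1b.
  move: hd as1 close1 ts s1b szn ls; rewrite s1a => _ _ _ ts _ szn ls.
  have := ih a s x [::] [::]; rewrite /= subrr mulr0 add0r; exact.
- move=> [as1' close1' ts'] /= ls ls'.
  have s11' : s1 <= s1' by exact: hd.
  have s1'b : s1' <= b by rewrite -ls'; exact: close_tagged_le_last ts'.
  have ts1' : close_tagged g e s1 (s1' :: s') (x1' :: x').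
    split=> // t /andP[s1t ts1']; apply: close1'.
    by rewrite ts1' (le_trans as1).
  have Fm1 : nondecr_on s1 b F by move=> t t' h; apply: Fm; exact: le_trans h.
  have := ih s1 s x (s1' :: s') (x1' :: x') _ Fm1 ts ts1' ls ls'.
  rewrite /= -ltnS => /(_ szn) {}ih.
  (* Both tag values are compared with the value at the common left end [a], whence the factor 2. *)
  have x11' : `|g x1 - g x1'| <= 2 * e.
    rewrite mulr2n mulrDl mul1r.
    apply: le_trans (ler_distD (g a) _ _) _; apply: lerD.
      by apply: close1; rewrite lexx.
    by rewrite distrC; apply: close1'; rewrite lexx.
  have Fas1 : 0 <= F s1 - F a by rewrite subr_ge0; apply: Fm => //; exact: s1b.
  rewrite [X in `|X|](_ : _ = (g x1 - g x1') * (F s1 - F a) +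
    (RS_sum g F s1 s x - (g x1' * (F s1' - F s1) + RS_sum g F s1' s' x'))); last ring.
  rewrite [leRHS](_ : _ = 2 * e * (F s1 - F a) + 2 * e * (F b - F s1)); last ring.
  apply: le_trans (ler_normD _ _) _; apply: lerD => //.
  by rewrite normrM (ger0_norm Fas1) ler_wpM2r.
Qed.

Definition mesh_tagged d a (s x : seq R) := forall i : nat, (i < size s)%N ->
  (a :: s)`_i.+1 - (a :: s)`_i < d /\ (a :: s)`_i <= x`_i <= (a :: s)`_i.+1.

Lemma mesh_close_tagged g a b d e (s x : seq R) :
  (forall t t', a <= t <= b -> a <= t' <= b -> `|t - t'| < d -> `|g t - g t'| <= e) ->
  itv_partition a b s -> size x = size s -> mesh_tagged d a s x ->
  close_tagged g e a s x.
Proof.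
move=> + [+ /eqP].
elim: s a x => [|s1 s ih] a [|x1 x]//= gde /andP[as1 ps] ls [xs] m.
have ts : close_tagged g e s1 s x.
  apply: ih => //.
    move=> t t' /andP[s1t tb] /andP[s1t' t'b]; apply: gde.
      by rewrite tb (le_trans (ltW as1)).
    by rewrite t'b (le_trans (ltW as1)).
  by move=> i si; have := m i.+1 si.
have s1b : s1 <= b by rewrite -ls; exact: close_tagged_le_last ts.
have [s1a /andP[ax1 x1s1]] := m 0%N isT; rewrite /= in s1a ax1 x1s1.
split=> //; first exact: ltW.
move=> t /andP[at_ ts1]; apply: gde; [lra|lra|].
by rewrite ltr_norml; apply/andP; split; lra.
Qed.

Lemma exists_fine_partition a b d : 0 < d -> a < b -> exists s x : seq R,
  [/\ itv_partition a b s, size x = size s & mesh_tagged d a s x].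
Proof.
move=> d0 ab.
(* Cells of length [d / 2] are cut off one at a time, until the rest is shorter than [d]; the
   truncated quotient plus 1 bounds their number and serves for the induction. *)
have : b - a < d / 2 * (Num.truncn ((b - a) / (d / 2))).+1%:R.
  rewrite mulrC -ltr_pdivrMr ?divr_gt0//; exact: truncnS_gt.
move: (Num.truncn _).+1 => n; elim: n a ab => [|n ih] a ab.
  by rewrite mulr0; lra.
have [bad|dba] := ltP (b - a) d.
  move=> _; exists [:: b], [:: b]; split => //; first exact: itv_partition1.
  by move=> [|]//= _; split=> //; rewrite lexx ltW.
rewrite -[n.+1%:R]natr1 mulrDr mulr1 => h.
have /ih : a + d / 2 < b by lra.
case; first by lra.
move=> s [x [[ps ls] xs m]].
exists (a + d / 2 :: s), (a + d / 2 :: x); split => //=.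
- by split => //=; rewrite ps andbT; lra.
- by rewrite xs.
- by move=> [_|i] /=; [split; lra|exact: m].
Qed.

Lemma uniform_continuity_le g a b e : 0 < e -> {within `[a, b], continuous g} ->
  exists2 d, 0 < d & forall t t', a <= t <= b -> a <= t' <= b ->
    `|t - t'| < d -> `|g t - g t'| <= e.
Proof.
move=> e0 /(heine_cantor e0)[d d0 h]; exists d => // t t' ta t'a tt'.
exact/ltW/h.
Qed.

(** Sums over fine partitions are uniformly close to each other by [RS_sum_close]. The integral is
    obtained as their lower limit: the supremum of the numbers that lie below all sufficiently fine
    sums. *)
Lemma is_RS_integral_exists g F a b : a < b -> {within `[a, b], continuous g} ->
  nondecr_on a b F -> exists I, is_RS_integral a b g F I.
Proof.
move=> ab cg Fm.
have Fab : 0 <= F b - F a by rewrite subr_ge0; apply: Fm => //; exact: ltW.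
pose fine_sum d r := exists s x : seq R, [/\ itv_partition a b s, size x = size s,
  mesh_tagged d a s x & r = RS_sum g F a s x].
have closeP e : 0 < e -> exists2 d, 0 < d & forall r r',
    fine_sum d r -> fine_sum d r' -> `|r - r'| <= e.
  (* The added 1 keeps the divisor positive when [F a = F b]. *)
  move=> e0; pose e' := e / (2 * (F b - F a + 1)).
  have e'0 : 0 < e' by rewrite divr_gt0// mulr_gt0//; lra.
  have [d d0 h] := uniform_continuity_le e'0 cg; exists d => //.
  move=> _ _ [s [x [ps xs ms ->]]] [s' [x' [ps' xs' ms' ->]]].
  have [_ /eqP ls] := ps; have [_ /eqP ls'] := ps'.
  apply: le_trans (RS_sum_close Fm _ _ ls ls') _.
  - exact: mesh_close_tagged h ps xs ms.
  - exact: mesh_close_tagged h ps' xs' ms'.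
  - rewrite [leLHS](_ : _ = e * ((F b - F a) / (F b - F a + 1))); last first.
      by rewrite /e'; field; lra.
    by rewrite ger_pMr// ler_pdivrMr ?mul1r; lra.
have fineW d d' r : d <= d' -> fine_sum d r -> fine_sum d' r.
  move=> dd' [s [x [ps xs ms ->]]]; exists s, x; split=> // i si.
  by have [h1 h2] := ms i si; split=> //; exact: lt_le_trans dd'.
have fine_ex d : 0 < d -> exists r, fine_sum d r.
  move=> d0; have [s [x [ps xs ms]]] := exists_fine_partition d0 ab.
  by exists (RS_sum g F a s x), s, x.
pose A := [set r | exists2 d, 0 < d & forall r', fine_sum d r' -> r <= r'].
have ubA d e r : 0 < d -> (forall r r', fine_sum d r -> fine_sum d r' -> `|r - r'| <= e) ->
    fine_sum d r -> ubound A (r + e).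
  move=> d0 h rd z [d' d'0 zd'].
  have [r' r'd] : exists r', fine_sum (Num.min d d') r' by apply: fine_ex; rewrite lt_min d0.
  apply: le_trans (zd' r' _) _; first by apply: fineW r'd; rewrite ge_min lexx orbT.
  have := h r r' rd; rewrite ler_norml.
  case/(_ _)/andP => [|h1 h2]; last lra.
  by apply: fineW r'd; rewrite ge_min lexx.
exists (sup A) => e e0.
have e20 : 0 < e / 2 by lra.
have [d d0 h] := closeP _ e20.
exists d => // s x ps xs ms.
rewrite RS_sumE//.
have fs : fine_sum d (RS_sum g F a s x) by exists s, x.
have As : A (RS_sum g F a s x - e / 2).
  exists d => // r' r'd; have := h _ _ fs r'd.
  by rewrite ler_norml; case/andP => ? ?; lra.
have ub := ubA _ _ _ d0 h fs.
have h1 : sup A <= RS_sum g F a s x + e / 2 by apply: ge_sup => //; exists (RS_sum g F a s x - e / 2).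
have h2 : RS_sum g F a s x - e / 2 <= sup A by apply: ub_le_sup => //; exists (RS_sum g F a s x + e / 2).
by rewrite ltr_norml; lra.
Qed.

Lemma is_RS_integral_le g F a b c I : a < b -> nondecr_on a b F ->
  (forall t, a <= t <= b -> g t <= c) -> is_RS_integral a b g F I ->
  I <= c * (F b - F a).
Proof.
move=> ab Fm gc hI; apply/ler_addgt0Pr => e e0.
have [d d0 h] := hI _ e0.
have [s [x [ps xs ms]]] := exists_fine_partition d0 ab.
have := h _ _ ps xs ms; rewrite RS_sumE// ltr_norml => /andP[h1 h2].
suff : RS_sum g F a s x <= c * (F b - F a) by lra.
have [p /eqP ls] := ps.
suff le a' : a <= a' -> path <%O a' s -> last a' s = b -> size x = size s ->
    mesh_tagged d a' s x -> RS_sum g F a' s x <= c * (F b - F a') by exact: le.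
elim: s x a' {ps xs ms h1 h2 p ls} => [|s1 s ih] [|x1 x] a' aa' //=.
  by move=> _ <-; rewrite subrr mulr0.
move=> /andP[as1 ps] ls [xs] ms.
have s1b : s1 <= b.
  by rewrite -ls; have := itv_partition_le (conj ps (eqxx _)).
have as1' : a <= s1 by rewrite (le_trans aa') ?ltW.
have ms' : mesh_tagged d s1 s x by move=> i si; have := ms i.+1 si.
have := ih x s1 as1' ps ls xs ms'.
have [_ /= /andP[ax1 x1s1]] := ms 0%N isT.
have : g x1 <= c by apply: gc; lra.
have : 0 <= F s1 - F a' by rewrite subr_ge0; apply: Fm => //; exact: ltW.
nra.
Qed.

Lemma is_RS_integral_unique g F a b I J : a < b ->
  is_RS_integral a b g F I -> is_RS_integral a b g F J -> I = J.
Proof.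
move=> ab hI hJ; apply/eqP; rewrite -subr_eq0 -normr_le0; apply/ler_addgt0Pr => e e0.
have e20 : 0 < e / 2 by lra.
have [d d0 hd] := hI _ e20; have [d' d'0 hd'] := hJ _ e20.
have dd' : 0 < Num.min d d' by rewrite lt_min d0.
have [s [x [ps xs ms]]] := exists_fine_partition dd' ab.
have {}hd := hd s x ps xs; have {}hd' := hd' s x ps xs.
have : `|\sum_(i < size s) g x`_i * (F (a :: s)`_i.+1 - F (a :: s)`_i) - I| < e / 2.
  apply: hd => i si; have [h1 h2] := ms i si.
  by split=> //; apply: lt_le_trans h1 _; rewrite ge_min lexx.
have : `|\sum_(i < size s) g x`_i * (F (a :: s)`_i.+1 - F (a :: s)`_i) - J| < e / 2.
  apply: hd' => i si; have [h1 h2] := ms i si.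
  by split=> //; apply: lt_le_trans h1 _; rewrite ge_min lexx orbT.
rewrite !ltr_norml add0r ler_norml => /andP[h1 h2] /andP[h3 h4].
by apply/andP; split; lra.
Qed.

Lemma RS_integralP g F a b I : a < b -> is_RS_integral a b g F I ->
  RS_integral a b g F = I.
Proof.
move=> ab hI; apply: (is_RS_integral_unique ab _ hI).
exact: (@xgetPex _ 0 [set I | is_RS_integral a b g F I]) (ex_intro _ _ hI).
Qed.

Lemma RS_integral_le g F a b c : a < b -> {within `[a, b], continuous g} ->
  {in `[a, b] &, nondecreasing F} -> (forall t, a <= t <= b -> g t <= c) ->
  RS_integral a b g F <= c * (F b - F a).
Proof.
move=> ab cg /nondecr_onP Fm gc.
have [I hI] := is_RS_integral_exists ab cg Fm.
by rewrite (RS_integralP ab hI); exact: is_RS_integral_le hI.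
Qed.

Lemma RS_integral_cst1 F a b : a < b -> RS_integral a b (fun=> 1) F = F b - F a.
Proof.
move=> ab; apply: RS_integralP => // e e0; exists 1 => // s x [ps /eqP ls] xs _.
have := RS_sumE (fun=> 1) F a xs; rewrite /= => ->.
rewrite [X in `|X - _|](_ : _ = F b - F a) ?subrr ?normr0//.
elim: s a x xs {ab ps} ls => [|s1 s ih] a [|x1 x]//= => [_ ->|[xs] ls].
  by rewrite subrr.
by rewrite ih// mul1r addrC subrKA.
Qed.

End riemann_stieltjes.

(** * Positive functionals on bounded functions as Riemann-Stieltjes integrals *)

Section positive_functionals.
Context {R : realType}.
Variables a b : R.
Hypothesis ab : a < b.
Implicit Types (g h : R -> R) (t s : R).

Definition bounded_on : set (R -> R) :=
  [set h | exists c, forall t, a <= t <= b -> `|h t| <= c].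

Lemma bounded_onD g h : bounded_on g -> bounded_on h -> bounded_on (g + h).
Proof.
move=> [c gc] [d hd]; exists (c + d) => t tab.
by apply: le_trans (ler_normD _ _) _; apply: lerD; [exact: gc|exact: hd].
Qed.

Lemma bounded_onZ (r : R) h : bounded_on h -> bounded_on (r *: h).
Proof.
move=> [c hc]; exists (`|r| * c) => t tab.
by rewrite /GRing.scale/= normrM ler_wpM2l//; exact: hc.
Qed.

Lemma bounded_on0 : bounded_on 0.
Proof. by exists 0 => t _; rewrite normr0. Qed.

Lemma bounded_onM g h : bounded_on g -> bounded_on h -> bounded_on (fun t => g t * h t).
Proof.
move=> [c gc] [d hd]; exists (c * d) => t tab.
by rewrite normrM ler_pM//; [exact: gc|exact: hd].
Qed.

Lemma continuous_bounded_on g : {within `[a, b], continuous g} -> bounded_on g.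
Proof.
move=> cg; have /compact_bounded[c [_ hc]] := continuous_compact cg (@segment_compact _ a b).
exists (c + 1) => t tab; apply: (hc (c + 1)); first by rewrite ltrDl.
by exists t => //=; rewrite in_itv.
Qed.

(* The strict inequality a < t makes the integrator built from [initial_indicator]
   vanish at a, so that it also charges a point mass at a. *)
Definition initial_indicator t : R -> R := fun s => ((a < t) && (s <= t))%:R.

Lemma initial_indicator_bounded t : bounded_on (initial_indicator t).
Proof. by exists 1 => s _; rewrite /initial_indicator; case: andP; rewrite ?normr1 ?normr0. Qed.

Lemma initial_indicator_le s t : s <= t -> forall r, initial_indicator s r <= initial_indicator t r.
Proof.
move=> st r; rewrite /initial_indicator ler_nat.
by case: (boolP ((a < s) && _)) => // /andP // -[as_ rs]; rewrite (lt_le_trans as_ st) (le_trans rs st).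
Qed.

Variable mu : (R -> R) -> R.
Hypotheses (mu_lin : linear_on bounded_on mu)
  (mu_ge0 : forall h, bounded_on h -> (forall t, a <= t <= b -> 0 <= h t) -> 0 <= mu h).

Lemma positive_functional_le g h : bounded_on g -> bounded_on h ->
  (forall t, a <= t <= b -> g t <= h t) -> mu g <= mu h.
Proof.
move=> bg bh gh; have bNg := bounded_onZ (-1) bg.
have : 0 <= mu (h + (-1) *: g).
  apply: mu_ge0; first exact: bounded_onD.
  by move=> t tab; rewrite fctE /= scaleN1r subr_ge0 gh.
by rewrite mu_lin.1// mu_lin.2//; lra.
Qed.

Lemma positive_functional_eq g h : bounded_on g -> bounded_on h ->
  (forall t, a <= t <= b -> g t = h t) -> mu g = mu h.
Proof.
by move=> bg bh gh; apply/eqP; rewrite eq_le !positive_functional_le// => t /gh ->.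
Qed.

Let F t := mu (initial_indicator t).

Lemma initial_indicator_nondecr : {homo F : s t / s <= t}.
Proof.
by move=> s t st; apply: positive_functional_le => *; [exact: initial_indicator_bounded..|exact: initial_indicator_le].
Qed.

(** On each cell [g] stays within [e] of its tag value, so positivity squeezes [mu] of [g] times the
    indicator of the cell; linearity adds up the cells. *)
Lemma RS_sum_functional_close g e a' (s x : seq R) : bounded_on g -> a <= a' ->
  close_tagged g e a' s x ->
  `|RS_sum g F a' s x - mu (fun t => g t * (initial_indicator (last a' s) t - initial_indicator a' t))|
  <= e * (F (last a' s) - F a').
Proof.
move=> bg; have bI r r' : bounded_on (initial_indicator r - initial_indicator r').
  rewrite -[- _]scaleN1r; apply: bounded_onD; first exact: initial_indicator_bounded.
  exact/bounded_onZ/initial_indicator_bounded.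
have bgI r r' : bounded_on (fun t => g t * (initial_indicator r t - initial_indicator r' t)).
  by apply: bounded_onM => //; exact: bI.
have muI r r' : mu (initial_indicator r - initial_indicator r') = F r - F r'.
  rewrite -[- initial_indicator _]scaleN1r mu_lin.1 ?mu_lin.2; try exact: initial_indicator_bounded.
    by rewrite mulN1r.
  exact/bounded_onZ/initial_indicator_bounded.
elim: s x a' => [|s1 s ih] [|x1 x] a'//= aa'.
  move=> _; rewrite [X in mu X](_ : _ = 0 *: (0 : R -> R)); last first.
    by apply/funext => t; rewrite subrr mulr0 scale0r.
  by rewrite mu_lin.2 ?mul0r ?subrr ?normr0 ?mulr0//; exact: bounded_on0.
move=> [as1 cl ts].
have as1' : a <= s1 by exact: le_trans as1.
have {}ih := ih x s1 as1' ts.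
set l := last s1 s in ih *.
have -> : mu (fun t => g t * (initial_indicator l t - initial_indicator a' t)) =
    mu (fun t => g t * (initial_indicator l t - initial_indicator s1 t)) +
    mu (fun t => g t * (initial_indicator s1 t - initial_indicator a' t)).
  by rewrite -mu_lin.1//; congr mu; apply/funext => t; rewrite fctE; ring.
have cell : `|g x1 * (F s1 - F a') - mu (fun t => g t * (initial_indicator s1 t - initial_indicator a' t))|
    <= e * (F s1 - F a').
  (* For [t >= a] the difference is the indicator of the cell, which contains its left end point
     exactly when [a' = a]. *)
  have D t : initial_indicator s1 t - initial_indicator a' t = 0 \/
      initial_indicator s1 t - initial_indicator a' t = 1 /\ (a <= t -> `|g x1 - g t| <= e).
    rewrite /initial_indicator; have [as1t|Nas1t] := boolP ((a < s1) && (t <= s1)).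
      have [_|Naa't] := boolP ((a < a') && (t <= a')); first by left; rewrite subrr.
      right; rewrite mulr0n subr0; split=> // at_; apply: cl.
      have /andP[_ ->] := as1t; rewrite andbT.
      move: Naa't; rewrite negb_and -!leNgt -ltNge => /orP[h|/ltW//].
      exact: le_trans at_.
    have [/andP[aa't ta']|_] := boolP ((a < a') && (t <= a')); last by left; rewrite subrr.
    by rewrite (lt_le_trans aa't as1) (le_trans ta' as1) in Nas1t.
  have hZ r : bounded_on (r *: (initial_indicator s1 - initial_indicator a')) by exact: bounded_onZ.
  have muZ r : mu (r *: (initial_indicator s1 - initial_indicator a')) = r * (F s1 - F a').
    by rewrite mu_lin.2// muI.
  have h1 : mu (fun t => g t * (initial_indicator s1 t - initial_indicator a' t)) <=
      mu ((g x1 + e) *: (initial_indicator s1 - initial_indicator a')).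
    apply: positive_functional_le => // t /andP[at_ _]; rewrite !fctE /GRing.scale/=.
    case: (D t) => [->|[-> /(_ at_)]]; first by rewrite !mulr0.
    by rewrite !mulr1 ler_norml => /andP[? ?]; lra.
  have h2 : mu ((g x1 - e) *: (initial_indicator s1 - initial_indicator a')) <=
      mu (fun t => g t * (initial_indicator s1 t - initial_indicator a' t)).
    apply: positive_functional_le => // t /andP[at_ _]; rewrite !fctE /GRing.scale/=.
    case: (D t) => [->|[-> /(_ at_)]]; first by rewrite !mulr0.
    by rewrite !mulr1 ler_norml => /andP[? ?]; lra.
  by rewrite muZ in h1; rewrite muZ in h2; rewrite ler_norml; lra.
move: ih cell; rewrite !ler_norml => /andP[? ?] /andP[? ?]; lra.
Qed.

(** A fine sum approximates [mu] of [g] times the indicator of all cells together, and this product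
    agrees with [g] on [[a, b]]. *)
Lemma positive_functional_RS g : {within `[a, b], continuous g} ->
  is_RS_integral a b g F (mu g).
Proof.
move=> cg e e0; have bg := continuous_bounded_on cg.
have Fab : 0 <= F b - F a by rewrite subr_ge0; exact/initial_indicator_nondecr/ltW.
pose e' := e / (F b - F a + 1).
have e'0 : 0 < e' by rewrite divr_gt0//; lra.
have [d d0 hd] := uniform_continuity_le e'0 cg.
exists d => // s x ps xs ms; rewrite RS_sumE//.
have := RS_sum_functional_close bg (lexx a) (mesh_close_tagged hd ps xs ms).
have [_ /eqP ->] := ps.
rewrite [mu (fun=> _)](_ : _ = mu g); last first.
  apply: positive_functional_eq => //.
    apply: bounded_onM => //; rewrite (_ : (fun=> _) = initial_indicator b - initial_indicator a) //.
    rewrite -[- _]scaleN1r; apply: bounded_onD; first exact: initial_indicator_bounded.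
    exact/bounded_onZ/initial_indicator_bounded.
  by move=> t /andP[_ tb]; rewrite /initial_indicator ab tb ltxx subr0 mulr1.
move=> /le_lt_trans; apply.
rewrite /e' mulrAC -mulrA gtr_pMr// ltr_pdivrMr; lra.
Qed.

End positive_functionals.

(** * Lagrange duality *)

Section lagrange_duality.
Context {R : realType} {X : lmodType R} {M : nat}.
Variables (a b : R) (cost : X -> R) (G : 'I_M -> X -> R -> R) (p w : R) (us : X).
Hypotheses (ab : a < b)
  (cost_convex : forall r u v, 0 <= r -> r <= 1 ->
    cost (r *: u + (1 - r) *: v) <= r * cost u + (1 - r) * cost v)
  (G_convex : forall k t r u v, a <= t <= b -> 0 <= r -> r <= 1 ->
    G k (r *: u + (1 - r) *: v) t <= r * G k u t + (1 - r) * G k v t)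
  (G_cont : forall k u, {within `[a, b], continuous (G k u)})
  (w0 : 0 < w) (slater : forall k t, a <= t <= b -> G k us t <= - w)
  (weak : forall u, (forall k t, a <= t <= b -> G k u t <= 0) -> p <= cost u).

Let D : set ('I_M -> R -> R) := [set z | forall k, bounded_on a b (z k)].

(** Equivalently, [u] is feasible for the constraints perturbed by [z / s], so that
    [s * (cost u - p)] is a difference quotient in the direction [z] with step [1 / s]. *)
Let dominated (z : 'I_M -> R -> R) (s : R) (u : X) :=
  0 < s /\ forall k t, a <= t <= b -> s * G k u t <= z k t.

(* directional derivative at 0 of the value function
   z |-> inf {cost u | G u <= z} (minorized by p at 0) *)
Let deriv z := inf [set r | exists s u, dominated z s u /\ r = s * (cost u - p)].

Let D0 : D 0. Proof. by move=> k; exact: bounded_on0. Qed.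
Let DD z z' : D z -> D z' -> D (z + z').
Proof. by move=> Dz Dz' k; exact: bounded_onD. Qed.
Let DZ (r : R) z : D z -> D (r *: z).
Proof. by move=> Dz k; exact: bounded_onZ. Qed.

(** Perspectives of convex functions are subadditive: the convex combination of [u] and [u'] with
    weights proportional to [s] and [s'] serves. *)
Let dominatedD z z' s s' u u' : dominated z s u -> dominated z' s' u' ->
  exists2 v, dominated (z + z') (s + s') v &
    (s + s') * (cost v - p) <= s * (cost u - p) + s' * (cost u' - p).
Proof.
move=> [s0 su] [s'0 su'].
have ss0 : 0 < s + s' by lra.
pose r := s / (s + s').
have r0 : 0 <= r by rewrite divr_ge0; lra.
have r1 : r <= 1 by rewrite ler_pdivrMr//; lra.
have rs : (s + s') * r = s by rewrite /r mulrCA mulfV ?mulr1// gt_eqF.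
have rs' : (s + s') * (1 - r) = s' by rewrite mulrBr rs; ring.
clearbody r.
exists (r *: u + (1 - r) *: u').
  split=> // k t tab.
  have := G_convex k u u' tab r0 r1; rewrite -(ler_pM2l ss0) mulrDr !mulrA rs rs'.
  by have := su k t tab; have := su' k t tab; rewrite !fctE; lra.
have := cost_convex u u' r0 r1; rewrite -(ler_pM2l ss0) mulrDr !mulrA rs rs'; lra.
Qed.

(** The slack [w] of the Slater point, scaled by a large enough [s], exceeds any bounded
    perturbation in absolute value. *)
Let dominated_ex z : D z -> exists s, dominated z s us.
Proof.
move=> /choice[c hc].
have c0 : 0 <= \sum_k `|c k| by exact: sumr_ge0.
exists ((\sum_k `|c k|) / w + 1); split; first by rewrite ltr_wpDl// divr_ge0// ltW.
move=> k t tab; have := hc k t tab; rewrite ler_norml => /andP[+ _].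
apply: le_trans.
have := slater k tab; rewrite -(@ler_pM2l _ ((\sum_k `|c k|) / w + 1)); last first.
  by rewrite ltr_wpDl// divr_ge0// ltW.
move=> /le_trans; apply.
rewrite mulrN mulrDl mul1r divfK ?gt_eqF// lerN2.
apply: le_trans (ler_norm _) _; apply: (@le_trans _ _ (\sum_k `|c k|)).
  by rewrite (bigD1 k)//= lerDl; exact: sumr_ge0.
by rewrite lerDl ltW.
Qed.

Let dominated0 s u : dominated 0 s u -> 0 <= s * (cost u - p).
Proof.
move=> [s0 su]; rewrite pmulr_rge0// subr_ge0; apply: weak => k t tab.
by have := su k t tab; rewrite pmulr_rle0.
Qed.

Let DN z : D z -> D (- z). Proof. by rewrite -scaleN1r; exact: DZ. Qed.

Let deriv_le z s u : D z -> dominated z s u -> deriv z <= s * (cost u - p).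
Proof.
move=> Dz dz; apply: ge_inf; last by exists s, u.
(* Adding a point that dominates [- z] yields one that dominates 0, where [weak] applies; this
   bounds the infimum from below. *)
have [s' ds'] := dominated_ex (DN Dz).
exists (- (s' * (cost us - p))) => _ [s1 [u1 [d1 ->]]].
have [v + h] := dominatedD d1 ds'; rewrite subrr => /dominated0; lra.
Qed.

Let le_deriv z c : D z ->
  (forall s u, dominated z s u -> c <= s * (cost u - p)) -> c <= deriv z.
Proof.
move=> Dz h; apply: lb_le_inf => [|_ [s [u [d ->]]]]; last exact: h.
by have [s ds] := dominated_ex Dz; exists (s * (cost us - p)), s, us.
Qed.

Let deriv_sublinear : sublinear_on D deriv.
Proof.
split=> [z z' Dz Dz'|r z r0 Dz].
  rewrite -lerBlDr; apply: le_deriv => // s u d; rewrite lerBlDl -lerBlDr.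
  apply: le_deriv => // s' u' d'; rewrite lerBlDr.
  by have [v dv] := dominatedD d d'; have := deriv_le (DD Dz Dz') dv; lra.
rewrite -ler_pdivrMl//; apply: le_deriv => // s u [s0 su]; rewrite ler_pdivrMl// mulrA.
apply: deriv_le; first exact: DZ.
split=> [|k t tab]; first exact: mulr_gt0.
by rewrite -mulrA !fctE /GRing.scale/= ler_pM2l//; exact: su.
Qed.

(** The Slater point dominates a nonnegative [z] for every [s > 0]; let [s] tend to 0. *)
Let deriv_le0 z : D z -> (forall k t, a <= t <= b -> 0 <= z k t) -> deriv z <= 0.
Proof.
move=> Dz z0.
have c0 : 0 <= cost us - p.
  rewrite subr_ge0; apply: weak => k t tab; have := slater k tab; have := w0; lra.
apply/ler_addgt0Pr => e e0; rewrite add0r.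
have s0 : 0 < e / (cost us - p + 1) by rewrite divr_gt0//; lra.
have d : dominated z (e / (cost us - p + 1)) us.
  split=> // k t tab; apply: le_trans (z0 k t tab).
  by rewrite pmulr_rle0//; have := slater k tab; have := w0; lra.
apply: le_trans (deriv_le Dz d) _.
by rewrite mulrAC -mulrA ger_pMr// ler_pdivrMr; lra.
Qed.

Let emb k (h : R -> R) : 'I_M -> R -> R := fun j => if j == k then h else 0.

Let D_emb k h : bounded_on a b h -> D (emb k h).
Proof. by move=> bh j; rewrite /emb; case: ifP => // _; exact: bounded_on0. Qed.

(** Let [l] be linear below [deriv]. Minus its components are positive functionals by [deriv_le0],
    hence integrals. As [u] dominates [z = G u] with [s = 1], the bound of [l z] by [cost u - p] is
    the claimed inequality. *)
Theorem lagrange_multiplier_exists : exists m : 'I_M -> R -> R,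
  (forall k, {homo m k : s t / s <= t}) /\
  forall u, p <= cost u + \sum_(k < M) RS_integral a b (G k u) (m k).
Proof.
have [l [lD lZ] lle] := hahn_banach D0 DD DZ deriv_sublinear.
pose mu k h := - l (emb k h).
have muL k : linear_on (bounded_on a b) (mu k).
  split=> [g h bg bh|r h bh]; rewrite /mu.
    rewrite (_ : emb k (g + h) = emb k g + emb k h) ?lD ?opprD//; [exact: D_emb..|].
    by apply/funext => j; rewrite fctE /emb; case: ifP => //; rewrite addr0.
  rewrite (_ : emb k (r *: h) = r *: emb k h) ?lZ ?mulrN//; first exact: D_emb.
  by apply/funext => j; rewrite fctE /emb; case: ifP => //; rewrite scaler0.
have mu0 k h : bounded_on a b h -> (forall t, a <= t <= b -> 0 <= h t) -> 0 <= mu k h.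
  move=> bh h0; rewrite oppr_ge0; apply: le_trans (lle _ (D_emb k bh)) _.
  apply: deriv_le0; first exact: D_emb.
  by move=> j t tab; rewrite /emb; case: ifP => // _; exact: h0.
exists (fun k t => mu k (initial_indicator a t)); split=> [k|u].
  exact: initial_indicator_nondecr (muL k) (mu0 k).
have bG k : bounded_on a b (G k u) by exact: continuous_bounded_on.
under eq_bigr do rewrite (RS_integralP ab (positive_functional_RS ab (muL _) (@mu0 _) (@G_cont _ _))).
have lsum (r : seq 'I_M) : D (\sum_(k <- r) emb k (G k u)) /\
    l (\sum_(k <- r) emb k (G k u)) = \sum_(k <- r) l (emb k (G k u)).
  elim: r => [|k r [Dr lr]].
    by rewrite !big_nil; split => //; rewrite -(scale0r 0) lZ// mul0r.
  by rewrite !big_cons lD ?lr//; [split=> //; apply: DD|]; try exact: D_emb.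
rewrite sumrN -(lsum _).2.
have -> : \sum_(k < M) emb k (G k u) = G ^~ u.
  apply/funext => j; rewrite fct_sumE (bigD1 j)//= /emb eqxx big1 ?addr0// => k kj.
  by rewrite eq_sym (negbTE kj).
rewrite lerBrDr -lerBrDl; apply: le_trans (lle _ bG) _.
rewrite -[leRHS]mul1r; apply: deriv_le => //.
by split=> // k t tab; rewrite mul1r.
Qed.

End lagrange_duality.

(** * Bochner integrals *)

Section almost_everywhere.
Context {R : realType}.
Local Notation mu := (@lebesgue_measure R).
Implicit Types P Q S : R -> Prop.

#[local] Instance ae_filter_lebesgue : Filter (nbhs (almost_everywhere mu)).
Proof. exact: ae_filter_ringOfSetsType. Qed.

Lemma ae_imp P Q : (forall t, P t -> Q t) ->
  {ae mu, forall t, P t} -> {ae mu, forall t, Q t}.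
Proof. exact: filterS. Qed.

Lemma ae_imp2 P Q S : (forall t, P t -> Q t -> S t) ->
  {ae mu, forall t, P t} -> {ae mu, forall t, Q t} -> {ae mu, forall t, S t}.
Proof. exact: filterS2. Qed.

End almost_everywhere.

Section simple_functions.
Context {R : realType} {Y : normedModType R}.
Local Notation mu := (@lebesgue_measure R).
Implicit Types (s : R -> Y) (D : set R).

(** Simple functions are handled as [c \o r] with [r] a labelling. Distinct labels may carry the
    same value, so two simple functions can be put over one labelling by pairs. *)
Definition labelling {I : finType} (r : R -> I) := forall i, measurable (r @^-1` [set i]).

Lemma labelling_measurable {I : finType} (r : R -> I) (P : set I) :
  labelling r -> measurable (r @^-1` P).
Proof.
move=> mr; rewrite (_ : _ @^-1` _ = \bigcup_(i in P) r @^-1` [set i]).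
  by apply: fin_bigcup_measurable => //; exact: finite_finset.
by apply/seteqP; split=> [t Pt|t [i Pi /= rti]]; [exists (r t)|rewrite rti].
Qed.

Lemma labelling_measurable_fun {I : finType} (r : R -> I) D (f : I -> \bar R) :
  labelling r -> measurable_fun D (f \o r).
Proof.
move=> mr mD B mB; apply: measurableI => //.
by rewrite comp_preimage; exact: labelling_measurable.
Qed.

Lemma simple_functionP s : simple_function s <->
  exists (n : nat) (r : R -> 'I_n) (c : 'I_n -> Y), labelling r /\ s = c \o r.
Proof.
split=> [[fs ms]|[n [r [c [mr ->]]]]].
  have /finite_seqP[l sl] := fs.
  have s_l t : s t \in l by have : range s (s t) := (ex_intro2 _ _ t I erefl); rewrite sl.
  have lt_idx t : (index (s t) (undup l) < size (undup l))%N.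
    by rewrite index_mem mem_undup.
  exists (size (undup l)), (fun t => Ordinal (lt_idx t)), (tnth (in_tuple (undup l))).
  have Es : s = tnth (in_tuple (undup l)) \o fun t => Ordinal (lt_idx t).
    apply/funext => t /=; by rewrite (tnth_nth 0)/= nth_index// mem_undup.
  split=> // i; rewrite (_ : _ @^-1` _ = s @^-1` [set tnth (in_tuple (undup l)) i]) //.
  apply/seteqP; split=> [t|t]; first by move=> /= <-; rewrite [in LHS]Es.
  move=> /= sti; apply/val_inj => /=; rewrite sti (tnth_nth 0)/= index_uniq ?undup_uniq//.
split=> [|x]; last by rewrite comp_preimage; exact: labelling_measurable.
by apply: (@sub_finite_set _ _ (range c)) => [_ [t _ <-]|]; [exists (r t)|exact/finite_image/finite_finset].
Qed.

Section integral_of_labelled.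
Variable D : set R.
Hypotheses (mD : measurable D) (Dfin : (mu D < +oo)%E).
Variables (I : finType) (r : R -> I).
Hypothesis mr : labelling r.

Let cell i := fine (mu (D `&` r @^-1` [set i])).

Let cell_fin i : mu (D `&` r @^-1` [set i]) = (cell i)%:E.
Proof.
rewrite fineK// ge0_fin_numE//; apply: le_lt_trans Dfin.
by apply: le_measure; rewrite ?inE//; exact: measurableI mD (mr i).
Qed.

Lemma integral_labelled (f : I -> R) : (forall i, 0 <= f i) ->
  (\int[mu]_(t in D) (f (r t))%:E = (\sum_i cell i * f i)%:E)%E.
Proof.
move=> f0.
transitivity (\int[mu]_(t in D) (\sum_i (f i * \1_(r @^-1` [set i]) t)%:E))%E.
  apply: eq_integral => t _; rewrite sumEFin (bigD1 (r t))//= indicE mem_set//= mulr1.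
  rewrite big1 ?addr0// => i ir; rewrite indicE memNset ?mulr0//= => ri.
  by move: ir; rewrite -ri eqxx.
rewrite ge0_integral_sum//; last 2 first.
- by move=> i; apply/measurable_EFinP/measurable_funM => //; exact: measurable_indic (mr i).
- by move=> i t _; rewrite lee_fin mulr_ge0.
rewrite -sumEFin; apply: eq_bigr => i _.
under eq_integral do rewrite EFinM.
rewrite ge0_integralZl//; last by rewrite lee_fin.
  rewrite integral_indic//; last exact: mr i.
  by rewrite setIC [in RHS]mulrC EFinM; congr (_ * _)%E; exact: cell_fin.
by apply/measurable_EFinP; exact: measurable_indic (mr i).
Qed.

Lemma simple_integral_labelled (c : I -> Y) :
  simple_integral D (c \o r) = \sum_i cell i *: c i.
Proof.
have fr : finite_set (range (c \o r)).
  apply: (@sub_finite_set _ _ (range c)) => [_ [t _ <-]|]; first by exists (r t).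
  exact/finite_image/finite_finset.
rewrite /simple_integral fsbig_finite//=.
(* The level set of each value [x] is split into the cells whose label carries [x]. *)
transitivity (\sum_(x <- finmap.enum_fset (fset_set (range (c \o r)))) \sum_i (cell i * (c i == x)%:R) *: x).
  apply: eq_bigr => x _; rewrite -scaler_suml; congr (_ *: _).
  rewrite setIC -integral_indic//; last by rewrite comp_preimage; exact: labelling_measurable.
  rewrite [X in fine X](_ : _ =
      (\int[mu]_(t in D) ((fun i => (c i == x)%:R) (r t))%:E)%E); last first.
    apply: eq_integral => t _; rewrite indicE; congr (_%:R%:E); congr nat_of_bool.
    by apply/idP/eqP => [|h]; rewrite ?inE.
  by have := integral_labelled (fun i => ler0n R (c i == x)); rewrite /= => ->.
rewrite exchange_big/=; apply: eq_bigr => i _.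
have memE x : (x \in finmap.enum_fset (fset_set (range (c \o r)))) = (x \in range (c \o r)).
  by rewrite -(in_fset_set fr).
have [ci|ci] := boolP (c i \in range (c \o r)).
  rewrite (bigD1_seq (c i))/= ?memE// ?finmap.fset_uniq//.
  rewrite eqxx mulr1 big1 ?addr0// => x.
  by rewrite eq_sym => /negbTE ->; rewrite mulr0 scale0r.
(* A value [c i] that is not attained has an empty cell, so its term on the right vanishes too. *)
rewrite big1_seq => [|x /andP[_]].
  rewrite /cell (_ : r @^-1` _ = set0) ?setI0 ?measure0 ?scale0r//.
  apply/seteqP; split=> // t /= rti; move: ci => /negP; apply.
  by rewrite inE; exists t => //=; rewrite rti.
rewrite memE => xr.
have [xci|] := eqVneq (c i) x; first by rewrite xci xr in ci.
by rewrite mulr0 scale0r.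
Qed.

End integral_of_labelled.

Lemma norm_simple_integral_le D s : measurable D -> (mu D < +oo)%E -> simple_function s ->
  ((`|simple_integral D s|)%:E <= \int[mu]_(t in D) (`|s t|)%:E)%E.
Proof.
move=> mD Dfin /simple_functionP[n [r [c [mr ->]]]].
rewrite simple_integral_labelled// (integral_labelled mD Dfin mr (fun i => normr_ge0 (c i))).
rewrite lee_fin; apply: le_trans (ler_norm_sum _ _ _) _.
apply: ler_sum => i _; rewrite normrZ ger0_norm// fine_ge0//.
Qed.

End simple_functions.

(** * Linearity and norm estimate of the Bochner integral *)

Section bochner_integral.
Context {R : realType} {Y : normedModType R}.
Local Notation mu := (@lebesgue_measure R).
Implicit Types (s : R -> Y) (D : set R).

Lemma labelling_pair (I J : finType) (r : R -> I) (q : R -> J) :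
  labelling r -> labelling q -> labelling (fun t => (r t, q t)).
Proof.
move=> mr mq [i j]; rewrite (_ : _ @^-1` _ = r @^-1` [set i] `&` q @^-1` [set j]).
  exact: measurableI.
by apply/seteqP; split=> t /= [-> ->].
Qed.

Lemma simple_function_lin (a : R) s1 s2 : simple_function s1 -> simple_function s2 ->
  simple_function (a *: s1 + s2).
Proof.
move=> /simple_functionP[n [r [c [mr ->]]]] /simple_functionP[m [q [e [mq ->]]]].
split.
  apply: (@sub_finite_set _ _ (range (fun p : 'I_n * 'I_m => a *: c p.1 + e p.2))).
    by move=> _ [t _ <-]; exists (r t, q t).
  exact/finite_image/finite_finset.
move=> x.
exact: labelling_measurable [set p | a *: c p.1 + e p.2 = x] (labelling_pair mr mq).
Qed.

Lemma simple_integral_lin D (a : R) s1 s2 : measurable D -> (mu D < +oo)%E ->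
  simple_function s1 -> simple_function s2 ->
  simple_integral D (a *: s1 + s2) = a *: simple_integral D s1 + simple_integral D s2.
Proof.
move=> mD Dfin /simple_functionP[n [r [c [mr ->]]]] /simple_functionP[m [q [e [mq ->]]]].
have mrq := labelling_pair mr mq.
rewrite (_ : a *: (c \o r) + (e \o q) =
  (fun p : 'I_n * 'I_m => a *: c p.1 + e p.2) \o (fun t => (r t, q t)))//.
rewrite (_ : c \o r = (c \o fst) \o (fun t => (r t, q t)))//.
rewrite (_ : e \o q = (e \o snd) \o (fun t => (r t, q t)))//.
rewrite !simple_integral_labelled// scaler_sumr -big_split/=.
by apply: eq_bigr => i _; rewrite scalerDr !scalerA mulrC.
Qed.

Lemma measurable_norm_simple D s : simple_function s ->
  measurable_fun D (fun t => (`|s t|)%:E).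
Proof.
move=> /simple_functionP[n [r [c [mr ->]]]].
exact: labelling_measurable_fun (fun i => (`|c i|)%:E) mr.
Qed.

Lemma measurable_norm_simple_sub D s1 s2 : simple_function s1 -> simple_function s2 ->
  measurable_fun D (fun t => (`|s1 t - s2 t|)%:E).
Proof.
move=> ss1 ss2; have := @measurable_norm_simple D ((-1) *: s2 + s1).
rewrite (_ : (fun t => (`|((-1) *: s2 + s1) t|)%:E) = (fun t => (`|s1 t - s2 t|)%:E)).
  by apply; exact: simple_function_lin.
by apply/funext => t; rewrite !fctE scaleN1r addrC.
Qed.

Lemma has_bochner_integral_lin D (a : R) (h1 h2 : R -> Y) (I1 I2 : Y) :
  measurable D -> (mu D < +oo)%E ->
  has_bochner_integral D h1 I1 -> has_bochner_integral D h2 I2 ->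
  has_bochner_integral D (a *: h1 + h2) (a *: I1 + I2).
Proof.
move=> mD Dfin [s [ss s_ae s_cauchy sI]] [q [sq q_ae q_cauchy qI]].
exists (fun n => a *: s n + q n); split.
- by move=> n; exact: simple_function_lin.
- apply: ae_imp2 s_ae q_ae => t hs hq Dt.
  by apply: cvgD; [apply: cvgZr; exact: hs|exact: hq].
- move=> e e0; pose e1 := e / 2 / (`|a| + 1).
  have a1 : 0 < `|a| + 1 by rewrite ltr_wpDl.
  have e10 : 0 < e1 by rewrite !divr_gt0.
  have e20 : 0 < e / 2 by rewrite divr_gt0.
  have [m hm] := s_cauchy _ e10; have [k hk] := q_cauchy _ e20.
  exists (maxn m k) => i j; rewrite !geq_max => /andP[mi ki] /andP[mj kj].
  have ms := measurable_norm_simple_sub (D := D) (ss i) (ss j).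
  have mq := measurable_norm_simple_sub (D := D) (sq i) (sq j).
  have mas : measurable_fun D (fun t => (`|a|)%:E * (`|s i t - s j t|)%:E)%E.
    exact: measurable_funeM.
  apply: (@le_lt_trans _ _ (\int[mu]_(t in D)
      ((`|a|)%:E * (`|s i t - s j t|)%:E + (`|q i t - q j t|)%:E))%E).
    apply: ge0_le_integral => //.
    + by apply: measurable_norm_simple_sub; exact: simple_function_lin.
    + exact: emeasurable_funD.
    + move=> t _; rewrite -EFinM -EFinD lee_fin !fctE -normrZ scalerBr.
      by rewrite opprD addrACA ler_normD.
  rewrite ge0_integralD//.
  rewrite ge0_integralZl//.
  apply: (@le_lt_trans _ _ ((`|a|)%:E * e1%:E + \int[mu]_(t in D) (`|q i t - q j t|)%:E)%E).
    by rewrite leeD2r// lee_wpmul2l// ltW// hm.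
  apply: (@lt_le_trans _ _ ((`|a|)%:E * e1%:E + (e / 2)%:E)%E).
    by rewrite lteD2lE//; exact: hk.
  rewrite -EFinM -EFinD lee_fin [leRHS]splitr lerD2r /e1 mulrCA ger_pMr//.
  by rewrite ler_pdivrMr// mul1r lerDl.
- under eq_fun do rewrite simple_integral_lin//.
  by apply: cvgD => //; exact: cvgZr.
Qed.

(* h itself need not be measurable: Fatou is applied to |s n - s j|, j -> oo,
   whose limit dominates the excess of |s n| over f. *)
Lemma norm_bochner_integral_le D (h : R -> Y) (I : Y) (f : R -> R) :
  measurable D -> (mu D < +oo)%E -> has_bochner_integral D h I ->
  measurable_fun D f -> (forall t, D t -> 0 <= f t) ->
  {ae mu, forall t, D t -> `|h t| <= f t} ->
  ((`|I|)%:E <= \int[mu]_(t in D) (f t)%:E)%E.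
Proof.
move=> mD Dfin [s [ss s_ae s_cauchy sI]] mf f0 hf.
apply/lee_addgt0Pr => e e0.
have e20 : 0 < e / 2 by rewrite divr_gt0.
have [m hm] := s_cauchy _ e20.
have mEf : measurable_fun D (EFin \o f) by exact/measurable_EFinP.
have key n : (m <= n)%N ->
    ((`|simple_integral D (s n)|)%:E <= \int[mu]_(t in D) (f t)%:E + (e / 2)%:E)%E.
  move=> mn; apply: le_trans (norm_simple_integral_le mD Dfin (ss n)) _.
  pose l t := limn_einf (fun j => (`|s n t - s j t|)%:E).
  have ml : measurable_fun D l.
    apply: measurableT_comp => //; apply: measurable_fun_limn_esup => j.
    by apply: measurableT_comp => //; exact: measurable_norm_simple_sub.
  have l0 t : (0 <= l t)%E.
    rewrite /l limn_einf_lim; apply: lime_ge; first exact: is_cvg_einfs.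
    by apply: nearW => j; apply: le_ereal_inf_tmp => _ [k _ <-].
  apply: (@le_trans _ _ (\int[mu]_(t in D) ((f t)%:E + l t))%E).
    apply: ae_ge0_le_integral => //.
    - exact: measurable_norm_simple.
    - by move=> t Dt; rewrite adde_ge0// lee_fin f0.
    - exact: emeasurable_funD.
    apply: ae_imp2 s_ae hf => t st hft Dt.
    have -> : l t = (`|s n t - h t|)%:E.
      apply: (cvg_limn_einf_sup _).1; apply: cvg_EFin; first exact: nearW.
      by apply: cvg_norm; apply: cvgB; [exact: cvg_cst|exact: st].
    rewrite -EFinD lee_fin -[s n t in leLHS](subrK (h t)).
    by apply: le_trans (ler_normD _ _) _; rewrite addrC lerD2r hft.
  rewrite ge0_integralD//.
  rewrite leeD2l//; apply: le_trans.
    by apply: fatou => // j; exact: measurable_norm_simple_sub.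
  rewrite limn_einf_lim; apply: lime_le; first exact: is_cvg_einfs.
  exists m => // j /= mj; apply: ge_ereal_inf; eexists; first by exists j => /=.
  by apply/ltW; exact: hm.
have /cvgrPdist_lt/(_ _ e20)[k _ hk] := sI.
have := key _ (leq_maxl m k); have := hk (maxn m k) (leq_maxr m k).
move=> h1 h2.
apply: (@le_trans _ _ ((`|simple_integral D (s (maxn m k))|)%:E + (e / 2)%:E)%E).
  rewrite -EFinD lee_fin -[I in leLHS](subrK (simple_integral D (s (maxn m k)))).
  by apply: le_trans (ler_normD _ _) _; rewrite addrC lerD2l ltW.
rewrite [in leRHS](splitr e) EFinD addeA.
by rewrite leeD2r.
Qed.

End bochner_integral.

(** * Mild solutions *)

Section gronwall.
Context {R : realType}.
Local Notation mu := (@lebesgue_measure R).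
Variables (t0 tf : R) (k : R -> R).
Hypotheses (k0 : forall s, 0 <= k s) (kint : mu.-integrable setT (EFin \o k)).

Let mass A := fine (\int[mu]_(s in A) (k s)%:E)%E.

Let mk A : measurable A -> measurable_fun A (EFin \o k).
Proof. by move=> mA; exact: measurable_funS (measurable_int _ kint). Qed.

Let massE A : measurable A -> (\int[mu]_(s in A) (k s)%:E = (mass A)%:E)%E.
Proof.
move=> mA; rewrite fineK//; apply: integrable_fin_num => //.
exact: integrableS kint.
Qed.

Let mass_ge0 A : 0 <= mass A.
Proof. by apply/fine_ge0/integral_ge0 => s _; rewrite lee_fin. Qed.

Let mass_le A : measurable A -> mass A <= mass setT.
Proof.
move=> mA; rewrite -lee_fin -!massE//; apply: ge0_subset_integral => //.
  exact: mk.
by move=> s _; rewrite lee_fin.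
Qed.

(** This is absolute continuity of the integral. Intervals are open on the left so that they can be
    adjoined to [[t0, s]] without overlap. *)
Let small_mass : exists2 h : R, 0 < h & forall s t, s <= t -> t <= s + h ->
  mass `]s, t] <= 2^-1.
Proof.
have [d [d0 hd]] := integral_normr_continuous kint (ltac:(by []) : 0 < 2^-1 :> R).
exists (d / 2); first by rewrite divr_gt0.
move=> s t st tsh; have := hd `]s, t]%classic; move=> /(_ (measurable_itv _)) h; apply: le_trans (ltW (h _)).
  rewrite /Rintegral /mass; under [in leRHS]eq_integral do rewrite ger0_norm//.
  exact: lexx.
rewrite [X in (X < _)%E]lebesgue_measure_itv/= lte_fin; case: ifP => _; rewrite ?lte_fin//.
lra.
Qed.

Let integral_kM_le A (f : R -> R) (c : R) : measurable A -> 0 <= c ->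
  measurable_fun A f -> (forall s, A s -> 0 <= f s <= c) ->
  (\int[mu]_(s in A) (k s * f s)%:E <= (c * mass A)%:E)%E.
Proof.
move=> mA c0 mf fc; rewrite EFinM -massE// -ge0_integralZl ?lee_fin//; last 2 first.
- exact: mk.
- by move=> s _; rewrite lee_fin.
apply: ge0_le_integral => //.
- by move=> s /fc/andP[fs0 _]; rewrite lee_fin mulr_ge0.
- apply/measurable_EFinP/measurable_funM => //.
  by apply/measurable_EFinP; exact: mk.
- by apply: measurable_funeM; exact: mk.
- by move=> s /fc/andP[_ fsc]; rewrite -EFinM lee_fin mulrC ler_wpM2r.
Qed.

(* [t0, tf] is covered by steps on which k has mass at most 1/2; on each of them
   the supremum of f is absorbed.  C depends on k only. *)
Lemma gronwall : exists2 C : R, 0 <= C & forall (f : R -> R) (a : R), 0 <= a ->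
  {within `[t0, tf], continuous f} -> (forall t, t0 <= t <= tf -> 0 <= f t) ->
  (forall t, t0 <= t <= tf ->
    ((f t)%:E <= a%:E + \int[mu]_(s in `[t0, t]) (k s * f s)%:E)%E) ->
  forall t, t0 <= t <= tf -> f t <= C * a.
Proof.
have [h h0 hsmall] := small_mass.
suff [C C0 hC] : exists2 C : R, 0 <= C &
    forall (f : R -> R) (a : R), 0 <= a ->
    {within `[t0, tf], continuous f} -> (forall t, t0 <= t <= tf -> 0 <= f t) ->
    (forall t, t0 <= t <= tf ->
      ((f t)%:E <= a%:E + \int[mu]_(s in `[t0, t]) (k s * f s)%:E)%E) ->
    forall t, t0 <= t <= tf -> t <= t0 + h * (Num.truncn ((tf - t0) / h)).+1%:R ->
    f t <= C * a.
  exists C => // f a a0 cf f0 hf t ttf; apply: (hC f) => //.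
  rewrite -lerBlDl mulrC -ler_pdivrMr//; apply: le_trans (ltW (truncnS_gt _)).
  by rewrite ler_pM2r ?invr_gt0//; lra.
elim: (Num.truncn _).+1 => [|n [C C0 ih]].
  exists 1 => // f a a0 cf f0 hf t ttf; rewrite mulr0 addr0 => tt0.
  have -> : t = t0 by apply/eqP; rewrite eq_le tt0; case/andP: ttf.
  have := hf t0; rewrite set_itv1 integral_set1 adde0 lee_fin mul1r; apply.
  by case/andP: ttf => *; rewrite lexx/=; lra.
(* The 1 next to [mass setT] covers the earlier steps, where [f] is at most [C * a]; the factor 2
   comes from absorbing [S / 2]. *)
exists (2 * (1 + C * (mass setT + 1))).
  by rewrite mulr_ge0// addr_ge0// mulr_ge0// addr_ge0.
move=> f a a0 cf f0 hf t ttf tn.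
have {}ih := ih f a a0 cf f0 hf.
pose J := [set s | t0 <= s <= tf /\ s <= t0 + h * n.+1%:R].
pose S := sup (f @` J).
have Jt : J t by [].
(* The supremum [S] must be finite for [S / 2] to be absorbed; continuity of [f] ensures it. *)
have ubS : has_ubound (f @` J).
  have [c hc] := continuous_bounded_on cf.
  by exists c => _ [s [sab _] <-]; exact: le_trans (ler_norm _) (hc _ sab).
have fS s : J s -> f s <= S by move=> Js; apply: ub_le_sup => //; exists s.
have S0 : 0 <= S by apply: le_trans (fS _ Jt); exact: f0.
have mf A : measurable A -> A `<=` `[t0, tf] -> measurable_fun A f.
  move=> mA At; apply: (measurable_funS _ At) => //.
  exact: subspace_continuous_measurable_fun.
have Ca : 0 <= C * a by exact: mulr_ge0.
have half s : J s -> f s <= (1 + C * (mass setT + 1)) * a + S / 2.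
  move=> [stf sn]; have [sn'|sn'] := leP s (t0 + h * n%:R).
    apply: le_trans (ih _ stf sn') _; have := mass_ge0 setT.
    have : 0 <= C * a * mass setT by exact: mulr_ge0.
    lra.
  set u := t0 + h * n%:R in sn'.
  have t0u : t0 <= u by rewrite lerDl mulr_ge0// ltW.
  rewrite -lee_fin; apply: le_trans (hf _ stf) _.
  have Es : `[t0, s]%classic = `[t0, u] `|` `]u, s].
    by rewrite -itv_bndbnd_setU ?bnd_simp//; exact: ltW.
  have A1 : `[t0, u] `<=` `[t0, tf].
    by move=> r /=; rewrite !in_itv/=; case/andP: stf => *; lra.
  have A2 : `]u, s] `<=` `[t0, tf].
    by move=> r /=; rewrite !in_itv/=; case/andP: stf => *; lra.
  rewrite Es ge0_integral_setU//; last 3 first.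
  - apply/measurable_EFinP/measurable_funM.
      by apply/measurable_EFinP; apply: mk; exact: measurableU.
    by apply: mf; [exact: measurableU|rewrite subUset].
  - move=> r Ar; rewrite lee_fin mulr_ge0// f0//.
    by have : `[t0, tf]%classic r by case: Ar => [/A1|/A2].
  - apply/disj_setPS => r [/=]; rewrite !in_itv/=; lra.
  have h1 := @integral_kM_le `[t0, u] f (C * a).
  have h2 := @integral_kM_le `]u, s] f S.
  apply: (@le_trans _ _ (a%:E + ((C * a * mass `[t0, u])%:E + (S * mass `]u, s])%:E))%E).
    rewrite leeD2l// leeD//.
      apply: h1 => //; first exact: mf.
      move=> r /[dup] /A1 /=; rewrite !in_itv/= => rtf /andP[_ ru].
      by rewrite f0//= ih.
    apply: h2 => //; first exact: mf.
    move=> r /[dup] /A2 /=; rewrite !in_itv/= => rtf /andP[_ rs].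
    by rewrite f0//= fS//; split=> //; exact: le_trans sn.
  rewrite -!EFinD lee_fin.
  have : C * a * mass `[t0, u] <= C * a * mass setT by rewrite ler_wpM2l// mass_le.
  have : S * mass `]u, s] <= S / 2.
    rewrite ler_wpM2l// hsmall//; first exact: ltW.
    by apply: le_trans sn _; rewrite -[n.+1%:R]natr1 /u; lra.
  by lra.
have : S <= (1 + C * (mass setT + 1)) * a + S / 2.
  by apply: ge_sup; [exists (f t), t|move=> _ [s Js <-]; exact: half].
by have := fS _ Jt; lra.
Qed.

End gronwall.

(** * Boundedness of strongly continuous semigroups *)

Section semigroups.
Context {R : realType}.

Lemma linear_map0 {V W : lmodType R} (f : V -> W) : linear f -> f 0 = 0.
Proof.
move=> lf; have := lf 1 0 0; rewrite !scale1r addr0 => h.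
by apply: (addrI (f 0)); rewrite addr0 -h.
Qed.

Lemma linear_mapZ {V W : lmodType R} (f : V -> W) (a : R) x : linear f ->
  f (a *: x) = a *: f x.
Proof. by move=> lf; have := lf a x 0; rewrite !addr0 (linear_map0 lf) addr0. Qed.

Context {Y : completeNormedModType R}.
Variable T : R -> Y -> Y.
Hypothesis hT : C0_semigroup T.

(** Otherwise there are times [t n], at most the inverse of [n + 1], at which the operator violates
    the bound [n + 1]. Right continuity at 0 bounds [T (t n) x] for each fixed [x], which
    contradicts Banach-Steinhaus. *)
Lemma C0_semigroup_bounded_near0 : exists2 d : R, 0 < d & exists2 K : R, 1 <= K &
  forall t x, 0 <= t <= d -> `|T t x| <= K * `|x|.
Proof.
have [Tlin T0 _ Tcont] := hT.
apply: contrapT => /forall2NP nbd.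
have /choice[t ht] : forall n : nat, exists t : R,
    0 <= t <= n.+1%:R^-1 /\ exists x, n.+1%:R * `|x| < `|T t x|.
  move=> n; have [|/forall2NP h] := nbd n.+1%:R^-1; first by rewrite invr_gt0 ltr0n.
  have [|/existsNP[t /existsNP[x /not_implyP[td /negP]]]] := h n.+1%:R.
    by rewrite ler1n.
  by rewrite -ltNge => ?; exists t; split=> //; exists x.
have [||M hM] := @Banach_Steinhauss R Y Y [set T (t n) | n in [set: nat]] _ _ 1.
- move=> _ [n _ <-]; have [/andP[tn0 _] _] := ht n.
  have [lT [C hC]] := Tlin _ tn0; split=> // r.
  exists (`|C| * r) => x xr; apply: le_trans (hC x) _.
  by apply: le_trans (ler_wpM2l (normr_ge0 C) xr); rewrite ler_wpM2r// ler_norm.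
- move=> x; have /cvgrPdist_lt/(_ _ ltr01) := Tcont x.
  rewrite /at_right /within /= => /nbhs_ballP[e /= e0 he].
  pose N := Num.truncn e^-1.
  (* The finitely many early terms are bounded by their sum, the later ones by continuity at 0. *)
  exists (`|x| + 1 + \sum_(i < N.+1) `|T (t i) x|) => _ [n _ <-].
  have [nN|Nn] := leqP n N.
    apply: (@le_trans _ _ (\sum_(i < N.+1) `|T (t i) x|)); last by rewrite lerDr addr_ge0.
    by rewrite (bigD1 (Ordinal (nN : (n < N.+1)%N)))//= lerDl sumr_ge0.
  apply: (@le_trans _ _ (`|x| + 1)); last by rewrite lerDl sumr_ge0.
  have [/andP[tn0 tn] _] := ht n.
  have [->|tn0'] := eqVneq (t n) 0; first by rewrite T0 lerDl.
  have : `|x - T (t n) x| < 1.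
    apply: he; last by rewrite lt_neqAle eq_sym tn0'.
    rewrite /ball/= sub0r normrN ger0_norm//; apply: le_lt_trans tn _.
    rewrite invf_plt ?posrE ?ltr0n//; apply: lt_le_trans (truncnS_gt _) _.
    by rewrite ler_nat ltnS ltnW.
  rewrite distrC => h; rewrite -[T _ _](subrK x) addrC.
  by apply: le_trans (ler_normD _ _) _; rewrite lerD2l ltW.
- pose n := Num.truncn M.
  have [/andP[tn0 _] [x hx]] := ht n.
  have [lT _] := Tlin _ tn0.
  have x0 : 0 < `|x|.
    rewrite normr_gt0; apply/eqP => x0; move: hx.
    by rewrite x0 (linear_map0 lT) normr0 mulr0 ltxx.
  have := hM (T (t n)) (ex_intro2 _ _ n I erefl) (`|x|^-1 *: x).
  rewrite normrZ normfV normr_id mulVf ?gt_eqF// => /(_ (lexx _)).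
  rewrite (linear_mapZ _ _ lT) normrZ normfV normr_id ler_pdivrMl// mulrC => h.
  have := lt_le_trans hx h; rewrite ltr_pM2r// => h'.
  by have := truncnS_gt M; lra.
Qed.

(** The semigroup law reaches [t] in steps of length [d], each costing a factor [K >= 1]. *)
Lemma C0_semigroup_bounded (b : R) : exists2 K : R, 0 <= K &
  forall t x, 0 <= t <= b -> `|T t x| <= K * `|x|.
Proof.
have [_ _ TD _] := hT.
have [d d0 [K K1 hK]] := C0_semigroup_bounded_near0.
have K0 : 0 <= K by rewrite (le_trans ler01).
exists (K ^+ (Num.truncn (b / d)).+1); first exact: exprn_ge0.
move=> t x /andP[t0 tb].
have : t <= (Num.truncn (b / d)).+1%:R * d.
  rewrite -ler_pdivrMr//; apply: le_trans (ltW (truncnS_gt _)).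
  by rewrite ler_pM2r ?invr_gt0.
elim: (Num.truncn _).+1 t x t0 {tb} => [|n ih] t x t0.
  rewrite mul0r => t0'; rewrite expr0 mul1r (_ : t = 0); last by apply/eqP; rewrite eq_le t0'.
  by have [_ -> _ _] := hT.
rewrite -natr1 mulrDl mul1r => tn.
have [td|dt] := leP t d.
  apply: le_trans (hK t x _) _; first by rewrite t0.
  by rewrite ler_wpM2r// exprS ler_peMr// exprn_ege1.
rewrite -(subrKC d t) TD; [|exact: ltW|by rewrite subr_ge0 ltW].
apply: le_trans (hK _ _ _) _; first by rewrite ltW/=.
by rewrite exprS -mulrA ler_wpM2l// ih ?subr_ge0; lra.
Qed.

End semigroups.

(** * A priori estimates for mild solutions *)

Section mild_solutions.
Context {R : realType} {Y : completeNormedModType R} {U : preTopologicalLmodType R} {N : nat}.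
Local Notation mu := (@lebesgue_measure R).

(** It lets bounds that hold almost everywhere on the open interval []t0, tf[] be used in integrals
    over [[t0, t]]. *)
Lemma ae_neq (c : R) : {ae mu, forall t, t != c}.
Proof.
exists [set c]; split; [exact: measurable_set1|exact: lebesgue_measure_set1|].
by move=> t /= /negP; rewrite negbK => /eqP.
Qed.

(* Although the exceptional null set of hlip depends on the points y1 and y2,
   the bound holds along a continuous path, by density of the rational times. *)
Lemma ae_lipschitz_along_path (t0 tf : R) (f : R -> Y -> U -> 'I_N -> Y)
    (k : R -> R) (w : R -> U) (v : R -> 'I_N) (z : R -> Y) :
  t0 < tf ->
  (forall i : 'I_N, {within [set p : R * Y * U | p.1.1 \in `[t0, tf]],
     continuous (fun p : R * Y * U => f p.1.1 p.1.2 p.2 i)}) ->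
  (forall y1 y2, {ae mu, forall t, t \in `]t0, tf[ ->
     `|f t y1 (w t) (v t) - f t y2 (w t) (v t)| <= k t * `|y1 - y2|}) ->
  {within `[t0, tf], continuous z} ->
  {ae mu, forall t, t \in `]t0, tf[ ->
     `|f t (z t) (w t) (v t) - f t 0 (w t) (v t)| <= k t * `|z t|}.
Proof.
move=> t0f fcont hlip cz.
(* The rationals are enumerated by [unpickle], with default 0, so that a single null set serves for
   all of them. *)
have : {ae mu, forall t, forall n : nat, t \in `]t0, tf[ ->
    `|f t (z (ratr (odflt 0 (unpickle n)))) (w t) (v t) - f t 0 (w t) (v t)| <=
    k t * `|z (ratr (odflt 0 (unpickle n)))|}.
  apply: (ae_foralln (mu := lebesgue_measure)) => n.
  by apply: ae_imp (hlip (z (ratr (odflt 0 (unpickle n)))) 0) => t + tt => /(_ tt); rewrite subr0.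
apply: ae_imp => t ht ttf; pose i := v t.
have {}ht (q : rat) : `|f t (z (ratr q)) (w t) i - f t 0 (w t) i| <= k t * `|z (ratr q)|.
  by have := ht (pickle q) ttf; rewrite pickleK.
have ctf : t \in `[t0, tf].
  by move: ttf; rewrite !in_itv/= => /andP[? ?]; rewrite !ltW.
have czt : {for t, continuous z} by exact: within_continuous_continuous ttf.
have cf : (f t y (w t) i) @[y --> z t] --> f t (z t) (w t) i.
  have /subspace_continuousP/(_ (t, z t, w t)) := fcont i.
  move=> /(_ ctf) h.
  have : (fun y => (t, y, w t)) @ (z t) --> within
      [set p : R * Y * U | p.1.1 \in `[t0, tf]] (nbhs (t, z t, w t)).
    move=> B; rewrite /within/= => hB.
    have ct : (fun y => (t, y, w t)) @ (z t) --> (t, z t, w t).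
      have ct : (fun y => (t, y)) @ (z t) --> (t, z t).
        by apply: (@cvg_pair _ _ _ (nbhs (z t)) (nbhs t) (nbhs (z t)) _ _ _ (cst t) id)
          => //; exact: cvg_cst.
      apply: (@cvg_pair _ _ _ (nbhs (z t)) (nbhs (t, z t)) (nbhs (w t)) _ _ _
        (fun y => (t, y)) (cst (w t))) => //; exact: cvg_cst.
    by apply: (@filterS _ (nbhs (z t)) _ _ _ _ (ct _ hB)) => y /= /(_ ctf).
  by move=> hz; exact: (cvg_comp _ _ hz h).
(* Only the time at which [z] is evaluated varies. If [F t] were negative, continuity would make [F]
   negative at a nearby rational time as well. *)
pose F r := k t * `|z r| - `|f t (z r) (w t) i - f t 0 (w t) i|.
have cF : F r @[r --> t] --> F t.
  apply: cvgB; first by apply: cvgM; [exact: cvg_cst|apply: cvg_norm; exact: czt].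
  by apply: cvg_norm; apply: cvgB; [exact: cvg_comp czt cf|exact: cvg_cst].
rewrite -subr_ge0 leNgt; apply/negP => Ft.
have /cvgrPdist_lt/(_ (- F t)) := cF.
rewrite oppr_gt0 => /(_ Ft) /nbhs_ballP[e /= e0 he].
have /rat_in_itvoo[q /itvP qt] : t < t + e by rewrite ltrDl.
have : `|F t - F (ratr q)| < - F t.
  apply: he; rewrite /ball/= distrC ger0_norm ?subr_ge0 ?qt//.
  by rewrite ltrBlDl qt.
by have := ht q; rewrite -subr_ge0 -/(F _) ltr_norml => ? /andP[? ?]; lra.
Qed.

Lemma norm_bochner_integral_itv_le (t0 tf t : R) (h : R -> Y) (I : Y) (k psi : R -> R) :
  t0 < tf -> t0 <= t <= tf -> has_bochner_integral `[t0, t] h I ->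
  (forall s, 0 <= k s) -> mu.-integrable setT (EFin \o k) ->
  {within `[t0, tf], continuous psi} -> (forall s, 0 <= psi s) ->
  {ae mu, forall s, s \in `]t0, tf[ -> s <= t -> `|h s| <= k s * psi s} ->
  ((`|I|)%:E <= \int[mu]_(s in `[t0, t]) (k s * psi s)%:E)%E.
Proof.
move=> t0f /andP[t0t ttf] hI k0 kint cpsi psi0 hh.
have mpsi : measurable_fun `[t0, t] psi.
  apply: (@measurable_funS _ _ _ _ `[t0, tf]) => //.
    by move=> s /=; rewrite !in_itv/= => /andP[-> /le_trans]; exact.
  exact: subspace_continuous_measurable_fun.
apply: norm_bochner_integral_le hI _ _ _ => //.
- rewrite lebesgue_measure_itv/=; case: ifP => //= _.
  by rewrite -EFinB ltry.
- apply: measurable_funM => //; apply/measurable_EFinP.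
  exact: measurable_funS (measurable_int _ kint).
- by move=> s _; rewrite mulr_ge0.
- apply: ae_imp2 (ae_neq t0) (ae_imp2 _ (ae_neq tf) hh); last first.
    move=> s stf sh; exact: (conj stf sh).
  move=> s st0 [stf sh]; rewrite /= in_itv/= => /andP[t0s st]; apply: sh => //.
  by rewrite in_itv/= !lt_neqAle t0s eq_sym st0 stf (le_trans st ttf).
Qed.

(** The absolute value of [k], extended by 0, provides the nonnegative kernel on the whole line that
    [gronwall] takes. *)
Lemma integrable_majorant (t0 tf : R) (k : R -> R) :
  mu.-integrable `]t0, tf[ (EFin \o k) -> exists k1 : R -> R,
  [/\ forall s, 0 <= k1 s, mu.-integrable setT (EFin \o k1) &
      forall s, s \in `]t0, tf[ -> k s <= k1 s].
Proof.
move=> kint; exists ((Num.norm \o k) \_ `]t0, tf[); split.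
- by move=> s; rewrite patchE; case: ifP => //=.
- rewrite -restrict_EFin; apply/integrable_restrict => //=; rewrite setTI.
  exact: integrable_norm.
- by move=> s st; rewrite patchE mem_set//=; exact: ler_norm.
Qed.

End mild_solutions.

Section mild_solution_estimates.
Context {R : realType} {Y : completeNormedModType R} {U : preTopologicalLmodType R} {N : nat}.
Local Notation mu := (@lebesgue_measure R).
Variables (t0 tf : R) (T : R -> Y -> Y) (f : R -> Y -> U -> 'I_N -> Y) (y0 : Y)
  (k : R -> R).
Hypotheses (t0f : t0 < tf) (hT : C0_semigroup T)
  (hf_cont : forall i : 'I_N, {within [set p : R * Y * U | p.1.1 \in `[t0, tf]],
     continuous (fun p : R * Y * U => f p.1.1 p.1.2 p.2 i)})
  (kint : mu.-integrable `]t0, tf[ (EFin \o k)).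
Implicit Types (w : R -> U) (v : R -> 'I_N) (z : R -> Y).

Definition lipschitz_in_state w v := forall y1 y2, {ae mu, forall t, t \in `]t0, tf[ ->
  `|f t y1 (w t) (v t) - f t y2 (w t) (v t)| <= k t * `|y1 - y2|}.

Let kernel_majorant : exists K (k1 : R -> R), [/\ 0 <= K,
  forall t x, 0 <= t <= tf - t0 -> `|T t x| <= K * `|x|,
  forall s, 0 <= K * k1 s, mu.-integrable setT (EFin \o (fun s => K * k1 s)) &
  forall s, s \in `]t0, tf[ -> k s <= k1 s].
Proof.
have [K K0 hK] := C0_semigroup_bounded hT (tf - t0).
have [k1 [k10 k1int kk1]] := integrable_majorant kint.
exists K, k1; split=> //; first by move=> s; rewrite mulr_ge0.
exact: (integrableZl measurableT K k1int).
Qed.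

(** The Lipschitz and growth bounds together give a right-hand side of norm at most [k] times the
    norm of [z] plus 1, so Gronwall is applied to this norm plus 1. The constant is uniform because
    [k] is common to all controls. *)
Lemma mild_solution_bounded : exists C : R, forall w v z,
  mild_solution t0 tf T f y0 w v z -> lipschitz_in_state w v ->
  {ae mu, forall t, t \in `]t0, tf[ -> `|f t 0 (w t) (v t)| <= k t} ->
  forall t, t0 <= t <= tf -> `|z t| <= C.
Proof.
have [K [k1 [K0 hK Kk10 Kk1int kk1]]] := kernel_majorant.
have [C C0 hC] := gronwall t0 tf Kk10 Kk1int.
exists (C * (K * `|y0| + 1)) => w v z [cz hz] hlip hbd t ttf.
apply: (@le_trans _ _ (`|z t| + 1)); first by rewrite lerDl.
apply: (hC (fun s => `|z s| + 1)) => //.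
- by rewrite addr_ge0// mulr_ge0.
- by move=> x; apply: cvgD; [apply: cvg_norm; exact: cz|exact: cvg_cst].
move=> {ttf} {}t ttf; have [I hI ->] := hz t (ltac:(by rewrite in_itv)).
have hI' : ((`|I|)%:E <= \int[mu]_(s in `[t0, t]) (K * k1 s * (`|z s| + 1))%:E)%E.
  apply: (norm_bochner_integral_itv_le t0f ttf hI Kk10 Kk1int).
  - by move=> x; apply: cvgD; [apply: cvg_norm; exact: cz|exact: cvg_cst].
  - by [].
  apply: ae_imp2 (ae_lipschitz_along_path t0f hf_cont hlip cz) hbd => s h1 h2 stf st.
  have {}h1 := h1 stf; have {}h2 := h2 stf; have ks := kk1 s stf.
  apply: le_trans (hK _ _ _) _.
    by move: stf ttf; rewrite in_itv/= => /andP[? ?] /andP[? ?]; lra.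
  rewrite -mulrA ler_wpM2l//.
  rewrite -(subrK (f s 0 (w s) (v s)) (f s (z s) (w s) (v s))).
  apply: le_trans (ler_normD _ _) _; rewrite mulrDr mulr1 lerD//; last exact: le_trans ks.
  by apply: le_trans h1 _; rewrite ler_wpM2r.
apply: (@le_trans _ _ ((K * `|y0|)%:E + (`|I|)%:E + 1%:E)%E).
  rewrite -!EFinD lee_fin lerD2r; apply: le_trans (ler_normD _ _) _; rewrite lerD2r.
  by apply: hK; lra.
by rewrite [(_ + 1)%:E]EFinD addeAC leeD2l.
Qed.

Hypothesis hf_lin : forall t i, t \in `[t0, tf] -> linear (fun p : Y * U => f t p.1 p.2 i).

(* The defect z solves the homogeneous equation, whose right-hand side
   f(s, z, 0, v) equals f(s, z, w0, v) - f(s, 0, w0, v). *)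
Lemma mild_solution_affine (r : R) w0 w1 w2 w3 v z1 z2 z3 : lipschitz_in_state w0 v ->
  mild_solution t0 tf T f y0 w1 v z1 -> mild_solution t0 tf T f y0 w2 v z2 ->
  mild_solution t0 tf T f y0 w3 v z3 ->
  {ae mu, forall t, t \in `[t0, tf] -> w3 t = r *: (-1 *: w2 t + w1 t) + w2 t} ->
  forall t, t0 <= t <= tf -> z3 t = r *: (-1 *: z2 t + z1 t) + z2 t.
Proof.
move=> hlip [cz1 hz1] [cz2 hz2] [cz3 hz3] hw.
have [K [k1 [K0 hK Kk10 Kk1int kk1]]] := kernel_majorant.
have [C C0 hC] := gronwall t0 tf Kk10 Kk1int.
(* The defect is built from operations [a *: p + q] only, the form in which linearity of the
   integral, of [T] and of [f] is available. *)
pose z := -1 *: (r *: (-1 *: z2 + z1) + z2) + z3.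
have cz : {within `[t0, tf], continuous z}.
  move=> x; apply: cvgD; last exact: cz3.
  apply: cvgZr; apply: cvgD; last exact: cz2.
  by apply: cvgZr; apply: cvgD; [apply: cvgZr; exact: cz2|exact: cz1].
suff z0 t : t0 <= t <= tf -> z t = 0.
  move=> t ttf; apply/eqP; rewrite -subr_eq0 -(z0 t ttf) /z !fctE addrC eq_sym.
  by apply/eqP; congr (_ + _); exact: scaleN1r.
move=> ttf; apply/eqP; rewrite -normr_le0 -(mulr0 C).
apply: (hC (fun s => `|z s|)) => //.
  by move=> x; apply: cvg_norm; exact: cz.
move=> {ttf} {}t ttf; rewrite add0e.
have tt : t \in `[t0, tf] by rewrite in_itv.
have [I1 hI1 e1] := hz1 t tt; have [I2 hI2 e2] := hz2 t tt.
have [I3 hI3 e3] := hz3 t tt.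
have Dfin : (mu `[t0, t] < +oo)%E.
  by rewrite lebesgue_measure_itv/=; case: ifP => //= _; rewrite -EFinB ltry.
have mD : measurable (`[t0, t] : set R) by [].
have hJ := has_bochner_integral_lin (-1) mD Dfin
  (has_bochner_integral_lin r mD Dfin (has_bochner_integral_lin (-1) mD Dfin hI2 hI1) hI2) hI3.
set J := _ + I3 in hJ.
(* The initial terms [T (t - t0) y0] cancel, as their coefficients add up to 0. *)
have -> : z t = J.
  rewrite /z /J !fctE e1 e2 e3.
  set c := T _ _; have cancel p q : - (c + p) + (c + q) = - p + q.
    by rewrite opprD addrACA addNr add0r.
  by rewrite !scaleN1r cancel [_ + (c + I2)]addrCA cancel.
apply: (norm_bochner_integral_itv_le t0f ttf hJ Kk10 Kk1int) => //.
  by move=> x; apply: cvg_norm; exact: cz.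
apply: ae_imp2 (ae_lipschitz_along_path t0f hf_cont hlip cz) hw => s h1 hw stf st.
have {}h1 := h1 stf; have ks := kk1 s stf.
have stc : s \in `[t0, tf] by move: stf; rewrite !in_itv/= => /andP[? ?]; rewrite !ltW.
have {}hw := hw stc.
have ts0 : 0 <= t - s <= tf - t0.
  by move: stf ttf; rewrite in_itv/= => /andP[? ?] /andP[? ?]; lra.
have [lT _] := (let: And4 Tlin _ _ _ := hT in Tlin) (t - s) (proj1 (andP ts0)).
have lf := hf_lin (v s) stc.
have -> : (-1 *: (r *: (-1 *: (fun s => T (t - s) (f s (z2 s) (w2 s) (v s))) +
    (fun s => T (t - s) (f s (z1 s) (w1 s) (v s)))) +
    (fun s => T (t - s) (f s (z2 s) (w2 s) (v s)))) +
    (fun s => T (t - s) (f s (z3 s) (w3 s) (v s)))) s =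
    T (t - s) (f s (z s) 0 (v s)).
  rewrite !fctE -!lT; congr T.
  have h3 := lf (-1) (z2 s, w2 s) (z1 s, w1 s).
  have h2 := lf r (-1 *: (z2 s, w2 s) + (z1 s, w1 s)) (z2 s, w2 s).
  have := lf (-1) (r *: (-1 *: (z2 s, w2 s) + (z1 s, w1 s)) + (z2 s, w2 s)) (z3 s, w3 s).
  rewrite h2 h3 /= => <-; rewrite hw; congr f.
  by rewrite scaleN1r addNr.
have zlin : f s (z s) 0 (v s) = f s (z s) (w0 s) (v s) - f s 0 (w0 s) (v s).
  have := lf (-1) (0, w0 s) (z s, w0 s); rewrite /= scaler0 add0r scaleN1r addNr => ->.
  by rewrite scaleN1r addrC.
rewrite zlin; apply: le_trans (hK _ _ ts0) _; rewrite -mulrA ler_wpM2l//.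
by apply: le_trans h1 _; rewrite ler_wpM2r.
Qed.

End mild_solution_estimates.

(** * The optimal value function *)

Section auxiliary_bounds.
Context {R : realType}.

(** It turns the extended-real suprema in the Lipschitz constant into real numbers: the bound [c]
    excludes [+oo], the member [x0] excludes [-oo]. *)
Lemma ereal_sup_bounded (E : set (\bar R)) (c x0 : R) : E x0%:E ->
  (forall e, E e -> exists2 r, e = r%:E & r <= c) ->
  exists s : R, [/\ ereal_sup E = s%:E, s <= c & forall r, E r%:E -> r <= s].
Proof.
move=> Ex0 Ec.
have lec : (ereal_sup E <= c%:E)%E.
  by apply: ge_ereal_sup => e /Ec[r -> rc]; rewrite lee_fin.
have gex0 : (x0%:E <= ereal_sup E)%E by exact: ereal_sup_ubound.
have fin : ereal_sup E \is a fin_num.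
  by rewrite fin_numE; case: (ereal_sup E) lec gex0.
exists (fine (ereal_sup E)); rewrite fineK//; split=> //.
  by rewrite -lee_fin fineK.
by move=> r Er; rewrite -lee_fin fineK//; exact: ereal_sup_ubound.
Qed.

Lemma bounded_setP (V : normedModType R) (A : set V) : bounded_set A ->
  exists2 c : R, 0 <= c & forall x, A x -> `|x| <= c.
Proof.
move=> [c [_ hc]]; exists (`|c| + 1); first by rewrite addr_ge0.
by apply: hc; rewrite ltr_pwDr// ler_norm.
Qed.

Lemma continuous_bounded_rectangle (F : R -> R -> R) (b c : R) :
  {within [set p : R * R | 0 <= p.1 /\ 0 <= p.2], continuous (fun p : R * R => F p.1 p.2)} ->
  exists d : R, forall s t, 0 <= s <= b -> 0 <= t <= c -> F s t <= d.
Proof.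
move=> cF.
have cpt : compact (`[0, b] `*` `[0, c] : set (R * R)).
  by apply: compact_setX; exact: segment_compact.
have cF' : {within `[0, b] `*` `[0, c], continuous (fun p : R * R => F p.1 p.2)}.
  apply: continuous_subspaceW cF => -[s t] /= [].
  by rewrite !in_itv/= => /andP[-> _] /andP[-> _].
have [d _ hd] := bounded_setP (compact_bounded (continuous_compact cF' cpt)).
exists d => s t sb tc; apply: le_trans (ler_norm _) (hd _ _).
by exists (s, t) => //=; rewrite !in_itv.
Qed.

Lemma continuous_bounded_segment (F : R -> R) (b : R) :
  {within [set a : R | 0 <= a], continuous F} ->
  exists d : R, forall s, 0 <= s <= b -> F s <= d.
Proof.
move=> cF.
have cF' : {within `[0, b], continuous F}.
  by apply: continuous_subspaceW cF => s /=; rewrite in_itv/= => /andP[].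
have [d hd] := continuous_bounded_on cF'.
by exists d => s sb; apply: le_trans (ler_norm _) (hd _ sb).
Qed.

Lemma sup_norm_le {V : normedModType R} (t0 tf c : R) (z : R -> V) : t0 < tf ->
  (forall t, t0 <= t <= tf -> `|z t| <= c) -> 0 <= sup_norm t0 tf z <= c.
Proof.
move=> t0f zc.
have zt0 : [set `|z t| | t in `[t0, tf]] `|z t0|.
  by exists t0 => //=; rewrite in_itv/= lexx ltW.
have ub : ubound [set `|z t| | t in `[t0, tf]] c.
  by move=> _ [t /= + <-]; rewrite in_itv/=; exact: zc.
apply/andP; split; last by apply: ge_sup ub; exists `|z t0|.
by apply: le_trans (ub_le_sup _ zt0); [exact: normr_ge0|exists c].
Qed.

(* Functions on [t0, tf] are total functions on R, so the cost could a priori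
   depend on their values outside [t0, tf]; continuity rules this out. *)
Lemma continuous_cost_ext {L Y X : completeNormedModType R} {N : nat} (t0 tf : R)
    (phi : L -> (R -> Y) -> X -> (R -> 'I_N) -> R) l u v z z' : t0 < tf ->
  continuous_cost t0 tf phi -> Vspace t0 tf v -> Cspace t0 tf z -> Cspace t0 tf z' ->
  (forall t, t0 <= t <= tf -> z t = z' t) -> phi l z u v = phi l z' u v.
Proof.
move=> t0f cphi hv cz cz' zz'.
apply/eqP; rewrite -subr_eq0 -normr_le0; apply/ler_addgt0Pr => e e0; rewrite add0r.
have [d d0 hd] := cphi l z' u v cz' hv e e0.
apply/ltW/hd => //; rewrite ?subrr ?normr0//.
  apply: (@le_lt_trans _ _ 0) => //.
  suff /andP[] : 0 <= sup_norm t0 tf (z - z') <= 0 by [].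
  by apply: sup_norm_le => // t tt; rewrite !fctE zz'// subrr normr0.
apply: (@le_lt_trans _ _ 0%E); last by rewrite lte_fin.
by apply/ess_supP/nearW => t; rewrite subrr normr0 mul0r.
Qed.

Lemma convex_functionP {V : lmodType R} (D : set V) (F : V -> R) (r : R) p q :
  convex_function D F -> D p -> D q -> 0 <= r -> r <= 1 ->
  F (r *: p + (1 - r) *: q) <= r * F p + (1 - r) * F q.
Proof.
move=> cF Dp Dq r0 r1.
by have := cF (Itv01 r0 r1) p q (mem_set Dp) (mem_set Dq).
Qed.

End auxiliary_bounds.

(** * Strong duality and the Lipschitz estimate *)

Section optimal_value.
Context {R : realType} {Y L X : completeNormedModType R}
  {U : preTopologicalLmodType R} {N M : nat}.
Local Notation mu := (@lebesgue_measure R).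
Variables (t0 tf : R) (T : R -> Y -> Y) (ev : X -> R -> U)
  (f : R -> Y -> U -> 'I_N -> Y) (y0 : Y) (y : X -> (R -> 'I_N) -> R -> Y)
  (phi : L -> (R -> Y) -> X -> (R -> 'I_N) -> R)
  (g : (R -> 'I_N) -> 'I_M -> L -> X -> R -> R) (k : R -> R)
  (Lphi : R -> R -> R) (Lg : R -> R)
  (lbar : L) (B : set L) (ubar : (R -> 'I_N) -> X).
Hypotheses (t0f : t0 < tf) (hT : C0_semigroup T)
  (hX : measurable_function_space t0 tf ev)
  (hy : forall u v, Vspace t0 tf v -> mild_solution t0 tf T f y0 (ev u) v (y u v))
  (hf_cont : forall i : 'I_N, {within [set p : R * Y * U | p.1.1 \in `[t0, tf]],
     continuous (fun p : R * Y * U => f p.1.1 p.1.2 p.2 i)})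
  (kint : mu.-integrable `]t0, tf[ (EFin \o k))
  (hf_lip : forall l u v, admissible t0 tf g l (u, v) ->
     lipschitz_in_state t0 tf f k (ev u) v /\
     {ae mu, forall t, t \in `]t0, tf[ -> `|f t 0 (ev u t) (v t)| <= k t})
  (hphi_cont : continuous_cost t0 tf phi)
  (hW : forall l, admissible t0 tf g l !=set0)
  (hf_lin : forall t i, t \in `[t0, tf] -> linear (fun p : Y * U => f t p.1 p.2 i))
  (hphi_conv : forall l v, Vspace t0 tf v ->
     convex_function [set p : (R -> Y) * X | Cspace t0 tf p.1]
       (fun p : (R -> Y) * X => phi l p.1 p.2 v))
  (hphi_lip : forall l1 l2 z u v, Cspace t0 tf z -> Vspace t0 tf v ->
     `|phi l1 z u v - phi l2 z u v| <= Lphi (sup_norm t0 tf z) `|u| * `|l1 - l2|)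
  (hLphi_cont : {within [set p : R * R | 0 <= p.1 /\ 0 <= p.2],
     continuous (fun p : R * R => Lphi p.1 p.2)})
  (hg_conv : forall v j l t, Vspace t0 tf v -> t \in `[t0, tf] ->
     convex_function [set: X] (fun u : X => g v j l u t))
  (hg_cont : forall v j l, Vspace t0 tf v ->
     {within [set p : X * R | p.2 \in `[t0, tf]], continuous (fun p : X * R => g v j l p.1 p.2)})
  (hLg_ge0 : forall a, 0 <= a -> 0 <= Lg a)
  (hLg_cont : {within [set a : R | 0 <= a], continuous Lg})
  (hg_lip : forall v j l1 l2 u t, Vspace t0 tf v -> t \in `[t0, tf] ->
     `|g v j l1 u t - g v j l2 u t| <= Lg `|u| * `|l1 - l2|)
  (Blbar : B lbar) (hB_bd : bounded_set B) (hCQ : CQ t0 tf g phi y B ubar).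

Local Notation V := (@Vspace R t0 tf N).
Local Notation nu := (nu t0 tf g phi y).
Local Notation Sbar := (Sbar t0 tf g phi y B ubar).
Local Notation Omega := (Omega t0 tf g phi y B).
Local Notation mass m j := (m j tf - m j t0).

Let g_continuous v j l u : V v -> {within `[t0, tf], continuous (g v j l u)}.
Proof.
move=> hv; apply/subspace_continuousP => t tt.
have /subspace_continuousP/(_ (u, t) tt) h := @hg_cont v j l hv.
have ht : (fun s => (u, s)) @ within `[t0, tf] (nbhs t) -->
    within [set p : X * R | p.2 \in `[t0, tf]] (nbhs (u, t)).
  move=> C; rewrite /within/= => hC.
  have ct : (fun s => (u, s)) @ t --> (u, t).
    by apply: (@cvg_pair _ _ _ (nbhs t) (nbhs u) (nbhs t) _ _ _ (cst u) id) => //; exact: cvg_cst.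
  by apply: (@filterS _ (nbhs t) _ _ _ _ (ct _ hC)) => s /= Cs st; exact: Cs.
exact: (cvg_comp _ _ ht h).
Qed.

Let slater_admissible v l : V v -> B l -> admissible t0 tf g l (ubar v, v).
Proof.
move=> hv Bl; split=> // j t tt; have [[w w0 hw] _ _ _] := hCQ.
by apply: le_trans (hw v l j t hv Bl tt) _; rewrite oppr_le0 ltW.
Qed.

Let V_inhabited : exists v, V v.
Proof. by have [[u v] [hv _]] := hW lbar; exists v. Qed.

(** The state is affine in the control and the cost is jointly convex. The Lipschitz bound for the
    uniqueness argument is taken along the Slater control, which is admissible, whereas [u1] and
    [u2] are arbitrary. *)
Lemma reduced_cost_convex l v r u1 u2 : V v -> 0 <= r -> r <= 1 ->
  phi l (y (r *: u1 + (1 - r) *: u2) v) (r *: u1 + (1 - r) *: u2) v <=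
  r * phi l (y u1 v) u1 v + (1 - r) * phi l (y u2 v) u2 v.
Proof.
move=> hv r0 r1; have [hlip _] := hf_lip (slater_admissible hv Blbar).
have hc u : Cspace t0 tf (y u v) by have [] := hy u hv.
have combE (E : lmodType R) (a b : E) : r *: a + (1 - r) *: b = r *: (-1 *: b + a) + b.
  by rewrite scalerBl scale1r scaleN1r [- b + a]addrC scalerBr -addrA [- _ + b]addrC addrA.
have cc : Cspace t0 tf (r *: y u1 v + (1 - r) *: y u2 v).
  by move=> x; apply: cvgD; apply: cvgZr; exact: hc.
rewrite (continuous_cost_ext (z' := r *: y u1 v + (1 - r) *: y u2 v) _ _ t0f hphi_cont hv)//.
  exact: (@convex_functionP _ _ _ _ _ (y u1 v, u1) (y u2 v, u2) (@hphi_conv l v hv)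
    (hc u1) (hc u2) r0 r1).
move=> t tt; rewrite [RHS]combE combE.
apply: (mild_solution_affine (r := r) t0f hT hf_cont kint hf_lin hlip
  (hy u1 hv) (hy u2 hv) (hy _ hv) _ tt).
have [_ ev_lin _] := hX.
apply: ae_imp2 (ev_lin r (-1 *: u2 + u1) u2) (ev_lin (-1) u2 u1) => s h1 h2 st.
by rewrite h1// h2.
Qed.

Let nu_fin l : B l -> exists p : R, nu l = p%:E.
Proof.
move=> Bl; have [_ _ [alpha ha] _] := hCQ.
have [v hv] := V_inhabited.
have : (nu l <= (phi l (y (ubar v) v) (ubar v) v)%:E)%E.
  by apply: ereal_inf_lbound; exists (ubar v, v) => //; exact: slater_admissible.
have := ha l Bl; case: (nu l) => [p||]// _ _; by exists p.
Qed.

(** For each [v], the number [p = nu l] is a lower bound for the problem with [v] fixed, so there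
    are multipliers with dual value at least [p]. Choice collects them into a family over all [v],
    and there is no gap even for [e = 0]. *)
Lemma strong_duality l e : B l -> 0 <= e -> exists rho, H_set t0 tf g phi y l e rho.
Proof.
move=> Bl e0; have [p nup] := nu_fin Bl.
have [[w w0 hw] _ _ _] := hCQ.
have tP t : (t0 <= t <= tf) = (t \in `[t0, tf]) by rewrite in_itv.
have /choice[rho hrho] : forall v, exists m, V v -> dual_cone t0 tf m /\
    forall u, p <= lagrangian t0 tf g phi y v l u m.
  move=> v; have [hv|nv] := pselect (V v); last by exists (fun _ _ => 0).
  have [|||||u hu|m [mm hm]] := @lagrange_multiplier_exists R X M t0 tf
    (fun u => phi l (y u v) u v) (fun j => g v j l) p w (ubar v) t0f.
  - by move=> r u1 u2; exact: reduced_cost_convex.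
  - move=> j t r u1 u2; rewrite tP => tt r0 r1.
    exact: (@convex_functionP _ _ _ _ _ u1 u2 (@hg_conv v j l t hv tt)).
  - by move=> j u; exact: g_continuous.
  - exact: w0.
  - by move=> j t; rewrite tP; exact: hw.
  - rewrite -lee_fin -nup; apply: ereal_inf_lbound; exists (u, v) => //.
  - exists m => _; split; last exact: hm.
    by move=> j s t _ _; exact: mm.
have dual_ge v : V v -> (p%:E <= dual_fun t0 tf g phi y v l (rho v))%E.
  move=> hv; apply: le_ereal_inf_tmp => _ [u _ <-]; rewrite lee_fin.
  exact: (hrho v hv).2.
have inf_ge : (p%:E <= inf_dual t0 tf g phi y l rho)%E.
  by apply: le_ereal_inf_tmp => _ [v hv <-]; exact: dual_ge.
exists rho; split; last first.
  by rewrite nup; apply: le_trans inf_ge; rewrite -EFinB lee_fin gerBl.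
split=> [v hv|].
  by split; [exact: (hrho v hv).1|apply: lt_le_trans (dual_ge v hv); rewrite ltNyr].
have [v hv] := V_inhabited.
(* Any value of the Lagrangian, here at [u = 0], bounds the dual value from above, so that it is
   finite. *)
have : (inf_dual t0 tf g phi y l rho <= (lagrangian t0 tf g phi y v l 0 (rho v))%:E)%E.
  apply: (@le_trans _ _ (dual_fun t0 tf g phi y v l (rho v))).
    by apply: ereal_inf_lbound; exists v.
  by apply: ereal_inf_lbound; exists 0.
by rewrite fin_numE; case: (inf_dual _ _ _ _ _ _ _) inf_ge.
Qed.

Let H_lagrangian_ge l e rho v u p : H_set t0 tf g phi y l e rho -> nu l = p%:E -> V v ->
  p - e <= lagrangian t0 tf g phi y v l u (rho v).
Proof.
move=> [_ h] nup hv; rewrite -lee_fin EFinB -nup; apply: le_trans h _.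
apply: (@le_trans _ _ (dual_fun t0 tf g phi y v l (rho v))).
  by apply: ereal_inf_lbound; exists v.
by apply: ereal_inf_lbound; exists u.
Qed.

Let mass_ge0 (m : 'I_M -> R -> R) j : dual_cone t0 tf m -> 0 <= mass m j.
Proof. by move=> hm; rewrite subr_ge0; apply: hm; rewrite ?in_itv/= ?lexx ltW. Qed.

Lemma multipliers_bounded : exists c : R, forall m, Omega m -> forall j, mass m j <= c.
Proof.
have [[w w0 hw] sup_lt [alpha ha] _] := hCQ.
have [b b0 hb] := bounded_setP hB_bd.
have [Phi hPhi] : exists Phi : R, forall v l, V v -> B l ->
    phi l (y (ubar v) v) (ubar v) v <= Phi.
  have [v1 hv1] := V_inhabited.
  set E := ereal_sup _ in sup_lt.
  have le_E v l : V v -> B l -> ((phi l (y (ubar v) v) (ubar v) v)%:E <= E)%E.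
    move=> hv Bl; apply: le_trans (ereal_sup_ubound _); last by exists v.
    by apply: ereal_sup_ubound; exists l.
  have := le_E _ _ hv1 Blbar.
  case: E sup_lt le_E => // Phi _ le_E _.
  by exists Phi => v l hv Bl; rewrite -lee_fin; exact: le_E.
(* At the Slater point the Lagrangian is at least [alpha - (b + b) ^+ 2], since [B] has diameter at
   most [b + b], and at most [Phi] minus [w] times the mass of any one component. *)
exists ((Phi - alpha + (b + b) ^+ 2) / w) => m [l1 [l2 [v [rho [B1 B2 hv hH ->]]]]] j.
have [p nup] := nu_fin B1.
have hcone : dual_cone t0 tf (rho v) by case: hH => -[/(_ v hv)[]].
have := H_lagrangian_ge (ubar v) hH nup hv.
have pa : alpha <= p by rewrite -lee_fin -nup; exact: ha.
have d2 : `|l1 - l2| ^+ 2 <= (b + b) ^+ 2.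
  rewrite lerXn2r ?nnegrE// ?addr_ge0//.
  by apply: le_trans (ler_normB _ _) _; rewrite lerD// hb.
have sum_le : \sum_(i < M) RS_integral t0 tf (g v i l1 (ubar v)) (rho v i) <=
    - w * mass (rho v) j.
  apply: (@le_trans _ _ (\sum_(i < M) - w * mass (rho v) i)).
    apply: ler_sum => i _; apply: RS_integral_le => //; first exact: g_continuous.
    by move=> t tt; apply: hw => //; rewrite in_itv.
  rewrite -mulr_sumr !mulNr lerN2 ler_pM2l// (bigD1 j)//= lerDl.
  by apply: sumr_ge0 => i _; exact: mass_ge0.
rewrite /lagrangian ler_pdivlMr//; have := hPhi v l1 hv B1; lra.
Qed.

Lemma states_bounded : exists c : R, forall p, Sbar p ->
  0 <= sup_norm t0 tf (y p.1 p.2) <= c.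
Proof.
have [C hC] := mild_solution_bounded y0 t0f hT hf_cont kint.
exists C => -[u v] [l1 [l2 [_ _ hadm _]]] /=.
have [hlip hbd] := hf_lip hadm; have [hv _] := hadm.
by apply: sup_norm_le => // t; exact: (hC _ _ _ (hy u hv)).
Qed.

Lemma optimal_value_lipschitz :
  Ctilde t0 tf g phi y Lphi Lg B ubar \is a fin_num /\
  forall l1 l2, B l1 -> B l2 ->
    (`|nu l1 - nu l2| <= Ctilde t0 tf g phi y Lphi Lg B ubar * `|l1 - l2|%:E)%E.
Proof.
have [v1 hv1] := V_inhabited.
have [c1 hc1] := multipliers_bounded.
(* Multipliers at [lbar] show that [Omega] is nonempty; the supremum over the empty set would be
   [-oo]. *)
have [rho1 hrho1] := strong_duality Blbar (sqr_ge0 `|lbar - lbar|).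
have Omega1 : Omega (rho1 v1) by exists lbar, lbar, v1, rho1.
have cone_Omega m : Omega m -> dual_cone t0 tf m.
  by move=> [l1 [l2 [v [rho [_ _ hv [[/(_ v hv)[? _] _] _] ->]]]]].
pose mx m := \big[Num.max/0]_(j < M) RS_integral t0 tf (fun=> 1) (m j).
(* The bound is [Num.max 0 c1] because the maximum over the components starts from 0. *)
have [mm [mmE _ hmm]] : exists s : R, [/\ ereal_sup [set (mx m)%:E | m in Omega] = s%:E,
    s <= Num.max 0 c1 & forall r, [set (mx m)%:E | m in Omega] r%:E -> r <= s].
  apply: (@ereal_sup_bounded _ _ _ (mx (rho1 v1))); first by exists (rho1 v1).
  move=> _ [m Om <-]; exists (mx m) => //; apply: bigmax_le => [|j _].
    by rewrite le_max lexx.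
  by rewrite (RS_integral_cst1 _ t0f) le_max hc1 ?orbT.
have mass_mm m j : Omega m -> mass m j <= mm.
  move=> Om; apply: le_trans (hmm (mx m) _); last by exists m.
  rewrite -(RS_integral_cst1 (m j) t0f); exact: (le_bigmax 0 (fun j => RS_integral t0 tf (fun=> 1) (m j))).
have mm0 : 0 <= mm.
  by apply: le_trans (hmm _ (ex_intro2 _ _ _ Omega1 erefl)); exact: bigmax_ge_id.
pose term p := Lphi (sup_norm t0 tf (y p.1 p.2)) `|p.1| + M%:R * Lg `|p.1| * mm.
have [c2 hc2] := states_bounded.
have [_ _ _ Sbd] := hCQ.
have [c3 c30 hc3] := bounded_setP Sbd.
have [c4 hc4] := continuous_bounded_rectangle c2 c3 hLphi_cont.
have [c5 hc5] := continuous_bounded_segment c3 hLg_cont.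
have Sbar1 : Sbar (ubar v1, v1).
  by exists lbar, lbar; split=> //; [exact: slater_admissible|rewrite lerDl sqr_ge0].
have [S [SE _ hS]] : exists s : R, [/\ ereal_sup [set (term p)%:E | p in Sbar] = s%:E,
    s <= c4 + M%:R * c5 * mm & forall r, [set (term p)%:E | p in Sbar] r%:E -> r <= s].
  apply: (@ereal_sup_bounded _ _ _ (term (ubar v1, v1))); first by exists (ubar v1, v1).
  move=> _ [p Sp <-]; exists (term p) => //.
  have p1 : 0 <= `|p.1| <= c3 by rewrite normr_ge0 hc3//; exists p.
  rewrite lerD//; first exact: hc4 (hc2 _ Sp) p1.
  by rewrite ler_wpM2r// ler_wpM2l ?ler0n// hc5.
have [b b0 hb] := bounded_setP hB_bd.
have [dd [ddE _ hdd]] : exists s : R,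
    [/\ ereal_sup [set `|l1 - l2|%:E | l1 in B & l2 in B] = s%:E, s <= b + b &
     forall r, [set `|l1 - l2|%:E | l1 in B & l2 in B] r%:E -> r <= s].
  apply: (@ereal_sup_bounded _ _ _ `|lbar - lbar|).
    by exists lbar => //; exists lbar.
  move=> _ [l1 B1 [l2 B2 <-]]; exists `|l1 - l2| => //.
  by apply: le_trans (ler_normB _ _) _; rewrite lerD// hb.
have CE : Ctilde t0 tf g phi y Lphi Lg B ubar = (S + 2 * dd)%:E.
  by rewrite /Ctilde ddE mmE (EFinD S) (EFinM 2) -SE.
rewrite CE; split=> //.
(* The one-sided estimate suffices, since [l1] and [l2] can be exchanged. *)
suff key l1 l2 p1 p2 : B l1 -> B l2 -> nu l1 = p1%:E -> nu l2 = p2%:E ->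
    p2 <= p1 + (S + 2 * dd) * `|l1 - l2|.
  move=> l1 l2 B1 B2; have [p1 n1] := nu_fin B1; have [p2 n2] := nu_fin B2.
  rewrite n1 n2 -EFinB -EFinM lee_fin ler_norml.
  have := key _ _ _ _ B1 B2 n1 n2; have := key _ _ _ _ B2 B1 n2 n1.
  by rewrite distrC => ? ?; apply/andP; split; lra.
move=> B1 B2 n1 n2.
(* For [l1 = l2] the tolerance [d ^+ 2] would be 0, and a minimizer may fail to exist. *)
have [l12|l12] := eqVneq l1 l2.
  by move: n1; rewrite l12 n2 subrr normr0 mulr0 addr0 => -[->].
set d := `|l1 - l2|; have d0 : 0 < d by rewrite normr_gt0 subr_eq0.
have ddd : d <= dd by apply: hdd; exists l1 => //; exists l2.
have fin1 : nu l1 \is a fin_num by rewrite n1.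
have [_ [[u v] hadm <-]] := lb_ereal_inf_adherent (exprn_gt0 2 d0) fin1.
rewrite -[ereal_inf _]/(nu l1) n1 -EFinD lte_fin /= => near_opt.
have [hv hg0] := hadm; rewrite /= in hv hg0.
(* Near-optimality gives membership because [nu l1] is at most the cost of the Slater control for
   the same [v]. *)
have Suv : Sbar (u, v).
  exists l1, l2; split=> //=; apply: le_trans (ltW near_opt) _; rewrite lerD2r.
  rewrite -lee_fin -n1; apply: ereal_inf_lbound; exists (ubar v, v) => //.
  exact: slater_admissible.
have [rho hrho] := strong_duality B2 (sqr_ge0 d).
have Orho : Omega (rho v) by exists l2, l1, v, rho; split=> //; rewrite distrC.
have h1 := H_lagrangian_ge u hrho n2 hv.
have h2 := hS (term (u, v)) (ex_intro2 _ _ _ Suv erefl).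
have cy : Cspace t0 tf (y u v) by have [] := hy u hv.
have h3 := hphi_lip l2 l1 u cy hv; rewrite [X in _ * X]distrC -/d ler_norml in h3.
(* As [g] is nonpositive at [l1], it is at most [Lg * d] at [l2]; integrating costs the mass of the
   multiplier, which is at most [mm]. *)
have h4 : \sum_(j < M) RS_integral t0 tf (g v j l2 u) (rho v j) <= M%:R * Lg `|u| * mm * d.
  apply: (@le_trans _ _ (\sum_(j < M) Lg `|u| * mm * d)); last first.
    by rewrite sumr_const card_ord -[leLHS]mulr_natl !mulrA.
  apply: ler_sum => j _; apply: (@le_trans _ _ (Lg `|u| * d * mass (rho v) j)).
    apply: RS_integral_le => //; [exact: g_continuous|exact: cone_Omega|].
    move=> t tt; have tc : t \in `[t0, tf] by rewrite in_itv.
    have := @hg_lip v j l2 l1 u t hv tc; have := hg0 j t tc.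
    by rewrite [X in _ * X]distrC -/d ler_norml => ? /andP[? ?]; lra.
  by rewrite -!mulrA [mm * d]mulrC !mulrA ler_wpM2l ?mass_mm// mulr_ge0// ?hLg_ge0// ltW.
(* The primal and the dual tolerance are both [d ^+ 2]; together they account for the summand
   [2 * dd] of the constant. *)
have dd2 : d ^+ 2 <= dd * d by rewrite expr2 ler_pM2r.
have h5 : term (u, v) * d <= S * d by rewrite ler_pM2r.
move: h1 h3 h5; rewrite /lagrangian /term/= => h1 /andP[_ h3] h5.
lra.
Qed.

End optimal_value.

Theorem theorem3 (R : realType) (Y L X : completeNormedModType R)
  (U : preTopologicalLmodType R) (dU : U -> U -> R)
  (hU : complete_metric dU) (N M : nat) (t0 tf : R) (ht : t0 < tf)
  (* semigroup and its generator *)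
  (DA : set Y) (A : Y -> Y) (T : R -> Y -> Y)
  (hT : C0_semigroup T) (hA : generates DA A T)
  (* X is the Banach space of controls u, with ev u : [t0, tf] -> U *)
  (ev : X -> R -> U) (hX : measurable_function_space t0 tf ev)
  (f : R -> Y -> U -> 'I_N -> Y) (y0 : Y)
  (y : X -> (R -> 'I_N) -> R -> Y)
  (hy : forall u v, Vspace t0 tf v ->
     mild_solution t0 tf T f y0 (ev u) v (y u v))
  (phi : L -> (R -> Y) -> X -> (R -> 'I_N) -> R)
  (g : (R -> 'I_N) -> 'I_M -> L -> X -> R -> R)
  (* assumption 1 *)
  (hf_cont : forall i : 'I_N,
     {within [set p : R * Y * U | p.1.1 \in `[t0, tf]],
       continuous (fun p : R * Y * U => f p.1.1 p.1.2 p.2 i)})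
  (hf_lip : exists2 k : R -> R,
     lebesgue_measure.-integrable `]t0, tf[ (EFin \o k) &
     forall l u v, admissible t0 tf g l (u, v) ->
       (forall y1 y2, {ae lebesgue_measure, forall t, t \in `]t0, tf[ ->
          `|f t y1 (ev u t) (v t) - f t y2 (ev u t) (v t)|
          <= k t * `|y1 - y2|}) /\
       {ae lebesgue_measure, forall t, t \in `]t0, tf[ ->
          `|f t 0 (ev u t) (v t)| <= k t})
  (* assumption 2 *)
  (hphi_cont : continuous_cost t0 tf phi)
  (hW : forall l, admissible t0 tf g l !=set0)
  (* assumption 3 *)
  (hf_lin : forall t i, t \in `[t0, tf] ->
     linear (fun p : Y * U => f t p.1 p.2 i))
  (hphi_conv : forall l v, Vspace t0 tf v ->
     convex_function [set p : (R -> Y) * X | Cspace t0 tf p.1]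
       (fun p : (R -> Y) * X => phi l p.1 p.2 v))
  (Lphi : R -> R -> R)
  (hLphi_ge0 : forall a b, 0 <= a -> 0 <= b -> 0 <= Lphi a b)
  (hLphi_cont : {within [set p : R * R | 0 <= p.1 /\ 0 <= p.2],
     continuous (fun p : R * R => Lphi p.1 p.2)})
  (hphi_lip : forall l1 l2 z u v, Cspace t0 tf z -> Vspace t0 tf v ->
     `|phi l1 z u v - phi l2 z u v|
     <= Lphi (sup_norm t0 tf z) `|u| * `|l1 - l2|)
  (hg_conv : forall v k l t, Vspace t0 tf v -> t \in `[t0, tf] ->
     convex_function [set: X] (fun u : X => g v k l u t))
  (hg_cont : forall v k l, Vspace t0 tf v ->
     {within [set p : X * R | p.2 \in `[t0, tf]],
       continuous (fun p : X * R => g v k l p.1 p.2)})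
  (Lg : R -> R)
  (hLg_ge0 : forall a, 0 <= a -> 0 <= Lg a)
  (hLg_cont : {within [set a : R | 0 <= a], continuous Lg})
  (hg_lip : forall v k l1 l2 u t, Vspace t0 tf v -> t \in `[t0, tf] ->
     `|g v k l1 u t - g v k l2 u t| <= Lg `|u| * `|l1 - l2|)
  (* the bounded neighborhood and the constraint qualification *)
  (lbar : L) (B : set L) (hB : nbhs lbar B) (hB_bd : bounded_set B)
  (ubar : (R -> 'I_N) -> X) (hCQ : CQ t0 tf g phi y B ubar) :
  Ctilde t0 tf g phi y Lphi Lg B ubar \is a fin_num /\
  forall l1 l2, B l1 -> B l2 ->
    (`|nu t0 tf g phi y l1 - nu t0 tf g phi y l2|
     <= Ctilde t0 tf g phi y Lphi Lg B ubar * `|l1 - l2|%:E)%E.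
Proof.
have [k kint hk] := hf_lip.
exact: (optimal_value_lipschitz ht hT hX hy hf_cont kint hk hphi_cont hW hf_lin
  hphi_conv hphi_lip hLphi_cont hg_conv hg_cont hLg_ge0 hLg_cont hg_lip
  (nbhs_singleton hB) hB_bd hCQ).
Qed.
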